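(* For every integer $1 \le k \le 7$ there is an algorithm that, given a permutation $\pi \in \mathbb{S}_n$, computes the $k$-profile of $\pi$, i.e. the vector $\left(\#\tau(\pi)\right)_{\tau \in \mathbb{S}_k}$, in $\widetilde{\mathcal{O}}(n^2)$ time and $\widetilde{\mathcal{O}}(n^2)$ space.
   Context: A permutation $\pi\in\mathbb{S}_n$ is a bijection of $[n]=\{1,\dots,n\}$, given to the algorithm as the length-$n$ vector $(\pi(1),\dots,\pi(n))$. For $\tau\in\mathbb{S}_k$, an occurrence of $\tau$ in $\pi$ is a $k$-tuple $1\le i_1<\dots<i_k\le n$ such that $\pi(i_j)<\pi(i_l)$ iff $\tau(j)<\tau(l)$ for all $j,l\in[k]$; $\#\tau(\pi)$ denotes the number of occurrences. The notation $\widetilde{\mathcal{O}}(\cdot)$ hides polylogarithmic factors in $n$ (computational model: word-RAM, $k$ fixed). *)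

(* Defs.v *)
From mathcomp Require Import all_boot all_fingroup.

Set Implicit Arguments.
Unset Strict Implicit.
Unset Printing Implicit Defensive.

(** * Permutation patterns *)

(* Positions and values are shifted by one: 'I_n stands for {1, ..., n}. *)

Section Patterns.
Variables (k n : nat).

Definition occurrence (tau : 'S_k) (pi : 'S_n) (i : {ffun 'I_k -> 'I_n}) :=
  [forall j : 'I_k, forall l : 'I_k, (j < l) ==> (i j < i l)] &&
  [forall j : 'I_k, forall l : 'I_k, (pi (i j) < pi (i l)) == (tau j < tau l)].

Definition pattern_count (tau : 'S_k) (pi : 'S_n) : nat :=
  #|[set i : {ffun 'I_k -> 'I_n} | occurrence tau pi i]|.

End Patterns.

(* The coordinates are listed in the order of the canonical enumeration of
   'S_k. *)
Definition profile (k n : nat) (pi : 'S_n) : seq nat :=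
  [seq pattern_count tau pi | tau : 'S_k].

(* The vector (pi(1), ..., pi(n)) with entries in {1, ..., n}. *)
Definition perm_vector (n : nat) (pi : 'S_n) : seq nat :=
  [seq (pi i).+1 | i : 'I_n].

(** * Word-RAM with [w]-bit words *)

Inductive binop :=
  OpAdd | OpSub | OpMul | OpDiv | OpMod | OpAnd | OpOr | OpXor | OpShl | OpShr |
  OpLt | OpEq.

(* Register operands and jump targets are literals of the program; only memory
   is addressed indirectly. *)
Inductive instr :=
  | Const of nat & nat               (* r := c *)
  | Move of nat & nat                (* r := r1 *)
  | Binop of binop & nat & nat & nat (* r := r1 op r2 *)
  | LoadM of nat & nat               (* r := memory[ra] *)
  | StoreM of nat & nat              (* memory[ra] := r *)
  | Jump of nat
  | JumpZ of nat & nat               (* if r = 0 goto l *)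
  | Halt.

Definition program := seq instr.

Record state := State { pc : nat; reg : nat -> nat; memory : nat -> nat }.

Definition upd (f : nat -> nat) (a v : nat) : nat -> nat :=
  fun x => if x == a then v else f x.

Section Machine.
Variables (w : nat) (p : program).

(* Subtraction wraps around; division by zero yields the total values of
   [divn] and [modn]. *)
Definition eval_binop (o : binop) (x y : nat) : nat :=
  match o with
  | OpAdd => x + y
  | OpSub => x + (2 ^ w - y)
  | OpMul => x * y
  | OpDiv => x %/ y
  | OpMod => x %% y
  | OpAnd => Nat.land x y
  | OpOr => Nat.lor x y
  | OpXor => Nat.lxor x y
  | OpShl => x * 2 ^ y
  | OpShr => x %/ 2 ^ y
  | OpLt => x < y
  | OpEq => x == y
  end %% 2 ^ w.

(* Running past the end of the program halts. *)
Definition fetch (s : state) : instr := nth Halt p (pc s).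

Definition halted (s : state) : bool :=
  if fetch s is Halt then true else false.

Definition step (s : state) : state :=
  let: State i R M := s in
  match fetch s with
  | Const r c => State i.+1 (upd R r (c %% 2 ^ w)) M
  | Move r r1 => State i.+1 (upd R r (R r1)) M
  | Binop o r r1 r2 => State i.+1 (upd R r (eval_binop o (R r1) (R r2))) M
  | LoadM r ra => State i.+1 (upd R r (M (R ra))) M
  | StoreM ra r => State i.+1 R (upd M (R ra) (R r))
  | Jump l => State l R M
  | JumpZ r l => State (if R r == 0 then l else i.+1) R M
  | Halt => s
  end.

(* One plus the address accessed by the next instruction, 0 if there is none. *)
Definition touched (s : state) : nat :=
  match fetch s with
  | LoadM _ ra | StoreM ra _ => (reg s ra).+1
  | _ => 0
  end.

(* The length of the shortest initial segment of memory containing all the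
   cells accessed during the first [t] steps. *)
Definition space_used (s : state) (t : nat) : nat :=
  \max_(i < t) touched (iter i step s).

(* The input occupies the first memory cells, its length is in register 0, and
   everything else is 0. *)
Definition init_state (input : seq nat) : state :=
  State 0 (upd (fun=> 0) 0 (size input)) (nth 0 input).

Definition computes (input output : seq nat) (time space : nat) : Prop :=
  exists t : nat,
    let final := iter t step (init_state input) in
    [/\ t <= time, halted final, space_used (init_state input) t <= space
      & mkseq (memory final) (size output) = output].

End Machine.

(* Words of b * (1 + floor(log2 n)) = Theta(log n) bits; for b > 0 a word can
   hold every number up to n. *)
Definition word_size (b n : nat) : nat := b * (trunc_log 2 n).+1.

Definition soft_O (f g : nat -> nat) : Prop :=
  exists C d n0 : nat,
    forall n, n0 <= n -> f n <= C * g n * trunc_log 2 n ^ d.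

(* Main.v *)
(* For a pattern tau of size k <= 7, split its k points ("labels") into bags of
   at most two points and arrange the bags in a tree.  Keeping only the order
   relations of tau inside a bag and between adjacent bags gives a relaxed
   counting problem.  It is solved in time n^2 polylog(n) by eliminating the
   bags one at a time: a bag is an n x n table indexed by pairs of points, and
   summing it into its parent is a 4-dimensional orthogonal range sum for each
   of the n^2 pairs, which dyadic decompositions turn into log^4(n) table
   look-ups.

   The relaxed count is the sum of #sigma over all pairs of linear extensions of
   the two partial orders that are left.  The decisive combinatorial fact is
   that S_k can be ordered so that each tau has a tree for which every other
   sigma in the sum comes earlier; then #tau is the relaxed count minus numbers
   that are already known.  The trees, up to the symmetries of the square, are
   the certificate data, and the triangularity is checked by computation. *)

Require Import Defs.
From Stdlib Require Import NArith FMapPositive.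
From mathcomp Require Import all_boot all_fingroup all_algebra zify ring.

Set Implicit Arguments.
Unset Strict Implicit.
Unset Printing Implicit Defensive.

Import GRing.Theory.

(** * Linear extensions *)

Section LinearExtensions.
Variable T : eqType.
Implicit Types (E : seq (T * T)) (s X : seq T) (g : T -> nat).

Definition minimal E s : seq T :=
  [seq a <- s | all (fun e => (e.2 != a) || (e.1 \notin s)) E].

Fixpoint linear_extensions_rec m E s : seq (seq T) :=
  if m is m'.+1 then
    [seq a :: X | a <- minimal E s, X <- linear_extensions_rec m' E (rem a s)]
  else [:: [::]].

Definition linear_extensions E s := linear_extensions_rec (size s) E s.

Lemma linear_extensions_size0 E s : size s = 0 -> linear_extensions E s = [:: [::]].
Proof. by rewrite /linear_extensions => ->. Qed.

Lemma linear_extensionsE m E s : size s = m.+1 ->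
  linear_extensions E s =
  [seq a :: X | a <- minimal E s, X <- linear_extensions E (rem a s)].
Proof.
rewrite {1}/linear_extensions => sz; rewrite sz /=.
congr flatten; apply/eq_in_map => a; rewrite mem_filter => /andP[_ sa].
by rewrite /linear_extensions size_rem // sz.
Qed.

Lemma perm_linear_extension E s X : X \in linear_extensions E s -> perm_eq X s.
Proof.
move Em: (size s) => m; elim: m s X Em => [|m IH] s X sz.
  by rewrite linear_extensions_size0 // inE (size0nil sz) => /eqP->.
rewrite (linear_extensionsE _ sz) => /allpairsPdep[a [Z []]].
rewrite mem_filter => /andP[_ sa] /IH pZ ->.
rewrite perm_sym (permPl (perm_to_rem sa)) perm_cons perm_sym pZ //.
by rewrite size_rem // sz.
Qed.

Lemma mem_linear_extensions E s X : uniq s -> perm_eq X s ->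
  (X \in linear_extensions E s) =
  all (fun e => (e.1 \in s) && (e.2 \in s) ==> (index e.1 X < index e.2 X)) E.
Proof.
move Em: (size s) => m; elim: m s X Em => [|m IH] s X sz us.
  rewrite (size0nil sz) linear_extensions_size0 // => /perm_nilP->.
  by rewrite inE eqxx; symmetry; apply/allP.
case: X => [/perm_size/=|a X pXs]; first by rewrite sz.
have sa : a \in s by rewrite -(perm_mem pXs) mem_head.
have pX : perm_eq X (rem a s).
  by rewrite -(perm_cons a) (perm_trans pXs) // perm_to_rem.
have -> : (a :: X \in linear_extensions E s) =
    all (fun e => (e.2 != a) || (e.1 \notin s)) E &&
      (X \in linear_extensions E (rem a s)).
  rewrite (linear_extensionsE _ sz).
  apply/allpairsPdep/andP => [[b [Z []]]|[min_a XE]].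
    by rewrite mem_filter => /andP[min_b _] ZE [-> ->].
  by exists a, X; rewrite mem_filter min_a.
rewrite IH ?rem_uniq ?size_rem ?sz // -all_predI; apply: eq_in_all => -[u v] _ /=.
rewrite !mem_rem_uniq // !inE [a == u]eq_sym [a == v]eq_sym.
case: (eqVneq v a) => [->|va] /=.
  by rewrite ltn0 sa andbF andbT implybF; case: (u \in s).
by case: (eqVneq u a) => [->|ua] //=; rewrite sa /= implybT.
Qed.

Lemma linear_extensions_uniq E s : uniq s -> uniq (linear_extensions E s).
Proof.
move Em: (size s) => m; elim: m s Em => [|m IH] s sz us.
  by rewrite linear_extensions_size0.
rewrite (linear_extensionsE _ sz); apply: allpairs_uniq_dep.
- exact: filter_uniq.
- move=> a; rewrite mem_filter => /andP[_ sa].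
  by apply: IH; rewrite ?rem_uniq // size_rem // sz.
- by move=> [a X] [b Y] _ _ /= [-> ->].
Qed.

Definition increasing g X := sorted (relpre g ltn) X.

Lemma increasing_index g X : increasing g X ->
  {in X &, forall u v, (index u X < index v X) = (g u < g v)}.
Proof.
have gtr : transitive (relpre g ltn) by move=> ? ? ?; apply: ltn_trans.
move=> incX u v uX vX; apply/idP/idP => [|guv].
  exact: (sorted_ltn_index gtr incX).
rewrite ltn_neqAle leqNgt; apply/andP; split.
  by apply: contraTneq guv => /(index_inj u uX vX) ->; rewrite ltnn.
by apply: contraTN guv => /(sorted_ltn_index gtr incX _ _ vX uX) /ltnW;
  rewrite -leqNgt.
Qed.

Lemma increasing_inj g X : increasing g X -> {in X &, injective g}.
Proof.
move=> incX u v Xu Xv guv; apply: (@index_inj _ u X) => //; apply/eqP.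
rewrite eqn_leq leqNgt (increasing_index incX) // [X in _ && X]leqNgt.
by rewrite (increasing_index incX) // guv ltnn.
Qed.

Lemma count_increasing_linear_extensions g E s : uniq s -> {in s &, injective g} ->
  all (fun e => (e.1 \in s) && (e.2 \in s)) E ->
  count (increasing g) (linear_extensions E s) = all (fun e => g e.1 < g e.2) E.
Proof.
move=> us ginj Es; set S := sort (relpre g leq) s.
have pS : perm_eq S s by rewrite /S perm_sort.
have incS : increasing g S.
  rewrite /increasing -sorted_map ltn_sorted_uniq_leq sorted_map map_inj_in_uniq.
    by rewrite (perm_uniq pS) us sort_sorted // => u v; apply: leq_total.
  by move=> u v; rewrite !(perm_mem pS); apply: ginj.
have -> : count (increasing g) (linear_extensions E s) =
    count_mem S (linear_extensions E s).
  apply: eq_in_count => X /perm_linear_extension pX /=; apply/idP/eqP => [incX|-> //].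
  apply: (@irr_sorted_eq _ (relpre g ltn)) => // [u v z|u|u].
  - exact: ltn_trans.
  - exact: ltnn.
  - by rewrite (perm_mem pX) (perm_mem pS).
rewrite count_uniq_mem ?linear_extensions_uniq // mem_linear_extensions //.
congr nat_of_bool; apply: eq_in_all => e /(allP Es)/andP[e1 e2].
by rewrite e1 e2 /= (increasing_index incS) ?(perm_mem pS).
Qed.

End LinearExtensions.

(** * Assignments of points to labels *)

(* Outside of ['I_k] the extension takes the junk value [0]. *)
Definition extend k n (f : 'I_k -> 'I_n) (l : nat) : nat :=
  oapp (fun j => val (f j)) 0 (insub l).

Lemma extendE k n (f : 'I_k -> 'I_n) (j : 'I_k) : extend f j = f j.
Proof. by rewrite /extend valK. Qed.

Lemma extend_lt k n (f : 'I_k -> 'I_n) l : l < k -> extend f l < n.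
Proof. by move=> lk; rewrite -[l]/(val (Ordinal lk)) extendE. Qed.

Lemma extend_injP k n (f : 'I_k -> 'I_n) :
  injective f <-> {in iota 0 k &, injective (extend f)}.
Proof.
split=> [f_inj a b|ext_inj i j fij].
  rewrite !mem_iota /= !add0n => ak bk.
  rewrite -[a]/(val (Ordinal ak)) -[b]/(val (Ordinal bk)).
  by rewrite !extendE => /val_inj/f_inj ->.
by apply/val_inj/ext_inj; rewrite ?mem_iota ?ltn_ord //= !extendE fij.
Qed.

Definition one_line k (tau : 'S_k) : seq nat :=
  [seq nat_of_ord (tau i) | i <- enum 'I_k].

Section OneLine.
Variable k : nat.
Implicit Types tau sigma rho : 'S_k.

Lemma size_one_line tau : size (one_line tau) = k.
Proof. by rewrite size_map size_enum_ord. Qed.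

Lemma nth_one_line tau (j : 'I_k) : nth 0 (one_line tau) j = tau j.
Proof. by rewrite (nth_map j) ?size_enum_ord // nth_ord_enum. Qed.

Lemma one_line_inj : injective (@one_line k).
Proof.
move=> sigma rho e; apply/permP => j; apply: val_inj.
by rewrite /= -!nth_one_line e.
Qed.

Lemma uniq_one_line tau : uniq (one_line tau).
Proof. by rewrite map_inj_uniq ?enum_uniq // => i j /val_inj/perm_inj. Qed.

Lemma mem_one_line tau a : (a \in one_line tau) = (a < k).
Proof.
apply/mapP/idP => [[i _ ->]|ak]; first exact: ltn_ord.
by exists ((tau^-1)%g (Ordinal ak)); rewrite ?mem_enum // permKV.
Qed.

Lemma perm_one_line tau : perm_eq (one_line tau) (iota 0 k).
Proof.
apply: uniq_perm; rewrite ?uniq_one_line ?iota_uniq // => a.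
by rewrite mem_one_line mem_iota.
Qed.

Lemma index_one_line tau (a : 'I_k) :
  index (nat_of_ord a) (one_line tau) = (tau^-1)%g a.
Proof.
rewrite -{1}[a](permKV tau) -(nth_one_line tau) index_uniq ?uniq_one_line //.
by rewrite size_one_line.
Qed.

Lemma one_line_surj s : perm_eq s (iota 0 k) -> exists tau : 'S_k, s = one_line tau.
Proof.
move=> ps; have ss : size s = k by rewrite (perm_size ps) size_iota.
have s_lt (j : 'I_k) : nth 0 s j < k.
  by have := mem_nth 0 (_ : j < size s); rewrite (perm_mem ps) mem_iota ss; apply.
have s_inj : injective (fun j => Ordinal (s_lt j)).
  move=> i j /(congr1 val)/eqP /=.
  by rewrite nth_uniq ?ss ?(perm_uniq ps) ?iota_uniq // => /eqP/val_inj.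
exists (perm s_inj); apply: (@eq_from_nth _ 0) => [|i]; first by rewrite size_one_line.
by rewrite ss => ik; rewrite (nth_one_line _ (Ordinal ik)) permE.
Qed.

Lemma increasing_one_lineP (g : nat -> nat) tau :
  reflect (forall i j : 'I_k, i < j -> g (tau i) < g (tau j))
    (increasing g (one_line tau)).
Proof.
apply: (iffP idP) => [incg i j|incg].
  by rewrite -(increasing_index incg) ?mem_one_line // !index_one_line !permK.
apply/(sortedP 0) => i; rewrite size_one_line => ik.
rewrite /= (nth_one_line _ (Ordinal (ltnW ik))) (nth_one_line _ (Ordinal ik)).
exact: incg.
Qed.

Lemma increasing_one_line_invP (g : nat -> nat) tau :
  reflect (forall a b : 'I_k, (g a < g b) = ((tau^-1)%g a < (tau^-1)%g b))
    (increasing g (one_line tau)).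
Proof.
apply: (iffP idP) => [incg a b|ltg].
  by rewrite -(increasing_index incg) ?mem_one_line // !index_one_line.
by apply/increasing_one_lineP => i j; rewrite ltg !permK.
Qed.

End OneLine.

Definition one_line_pattern_count k n (pi : 'S_n) (s : seq nat) : nat :=
  \sum_(tau : 'S_k | one_line tau == s) pattern_count tau pi.

Lemma one_line_pattern_countE k n (pi : 'S_n) (tau : 'S_k) :
  one_line_pattern_count k pi (one_line tau) = pattern_count tau pi.
Proof.
rewrite /one_line_pattern_count (eq_bigl _ _ (inj_eq (@one_line_inj k) ^~ tau)).
exact: big_pred1_eq.
Qed.

Lemma one_line_pattern_count_le k n (pi : 'S_n) s : perm_eq s (iota 0 k) ->
  one_line_pattern_count k pi s <= n ^ k.
Proof.
case/one_line_surj=> tau ->; rewrite one_line_pattern_countE.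
by apply: leq_trans (max_card _) _; rewrite card_ffun !card_ord.
Qed.

(* If X lists the labels from left to right and Y lists them from bottom to top,
   this is the one-line notation of the pattern that they form. *)
Definition combine (X Y : seq nat) : seq nat := [seq index x Y | x <- X].

Lemma combine_one_line k (sigma rho : 'S_k) :
  combine (one_line sigma) (one_line rho) = one_line (sigma * rho^-1)%g.
Proof.
by rewrite /combine -map_comp; apply: eq_map => i; rewrite /= index_one_line permM.
Qed.

Lemma sum_increasing_pair k n (pi : 'S_n) X Y :
  perm_eq X (iota 0 k) -> perm_eq Y (iota 0 k) ->
  \sum_(f : {ffun 'I_k -> 'I_n})
     (increasing (extend f) X && increasing (extend pi \o extend f) Y) =
  one_line_pattern_count k pi (combine X Y).
Proof.
case/one_line_surj=> sigma -> /one_line_surj[rho ->].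
rewrite combine_one_line one_line_pattern_countE.
pose along (s : 'S_k) (i : {ffun 'I_k -> 'I_n}) := [ffun j => i (s j)].
rewrite (reindex (along (sigma^-1)%g)) /=; last first.
  by exists (along sigma) => i _; apply/ffunP => j; rewrite !ffunE ?permK ?permKV.
rewrite /pattern_count -sum1dep_card [RHS]big_mkcond /=; apply: eq_bigr => i _.
have value (a : 'I_k) : extend (along (sigma^-1)%g i) (sigma a) = i a.
  by rewrite extendE ffunE permK.
suff -> : occurrence (sigma * rho^-1)%g pi i =
  increasing (extend (along (sigma^-1)%g i)) (one_line sigma) &&
  increasing (extend pi \o extend (along (sigma^-1)%g i)) (one_line rho) by case: ifP.
congr (_ && _).
  apply/forallP/increasing_one_lineP => [inc a b ab|inc a].
    by rewrite !value; have /forallP/(_ b)/implyP := inc a; apply.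
  by apply/forallP => b; apply/implyP => /inc; rewrite !value.
apply/forallP/increasing_one_line_invP => [ord a b|ord a].
  have /forallP/(_ ((sigma^-1)%g b))/eqP := ord ((sigma^-1)%g a).
  by rewrite !permM !permKV /= !extendE !ffunE.
apply/forallP => b; apply/eqP; rewrite !permM -ord /= !value.
by rewrite !extendE.
Qed.

(** * Trees of bags *)

(* The list of the bags, root first, each with the position of its parent; a
   one-point bag [{a}] is written [(a, a)]. *)
Notation bag_tree := (seq ((nat * nat) * nat)).

Definition bag (t : bag_tree) i : nat * nat := (nth ((0, 0), 0) t i).1.
Definition parent (t : bag_tree) i : nat := (nth ((0, 0), 0) t i).2.

Definition bag_labels (b : nat * nat) :=
  if b.1 == b.2 then [:: b.1] else [:: b.1; b.2].
Definition prefix_labels t m := flatten [seq bag_labels (bag t i) | i <- iota 0 m].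

Definition well_formed k t :=
  perm_eq (prefix_labels t (size t)) (iota 0 k) &&
  all (fun i => parent t i < i) (iota 1 (size t).-1).

Definition inner_links (b : nat * nat) := if b.1 == b.2 then [::] else [:: b].
Definition cross_links (b c : nat * nat) :=
  [:: (b.1, c.1); (b.1, c.2); (b.2, c.1); (b.2, c.2)].
Definition links t : seq (nat * nat) :=
  flatten [seq inner_links (bag t i) | i <- iota 0 (size t)] ++
  flatten [seq cross_links (bag t i) (bag t (parent t i)) | i <- iota 1 (size t).-1].

Definition orient (v : nat -> nat) (e : nat * nat) :=
  if v e.1 < v e.2 then e else (e.2, e.1).
Definition x_edges t := map (orient id) (links t).
Definition y_edges tau t := map (orient (nth 0 tau)) (links t).

Definition patterns k (tau : seq nat) t :=
  let LX := linear_extensions (x_edges t) (iota 0 k) in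
  let LY := linear_extensions (y_edges tau t) (iota 0 k) in
  [seq combine X Y | X <- LX, Y <- LY].

(* Nested conditionals instead of [&&] and [||], here and in [separated]: those
   would be evaluated eagerly, making the search exponential. *)
Fixpoint reach m (E : seq (nat * nat)) a b :=
  if m is m'.+1 then
    has (fun e => if e.1 == a then if e.2 == b then true else reach m' E e.2 b
                  else false) E
  else false.

Definition separated k tau t :=
  let EX := x_edges t in
  let EY := y_edges tau t in
  all (fun a => all (fun b =>
        if reach k EX b a then true
        else if reach k EY a b then true else reach k EY b a)
    (iota 0 a)) (iota 0 k).

Lemma mem_bag_labels b : (b.1 \in bag_labels b) && (b.2 \in bag_labels b).
Proof. by rewrite /bag_labels; case: eqP => [->|_]; rewrite !inE !eqxx ?orbT. Qed.

Lemma prefix_labelsS t m :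
  prefix_labels t m.+1 = prefix_labels t m ++ bag_labels (bag t m).
Proof. by rewrite /prefix_labels -addn1 iotaD map_cat flatten_cat /= cats0. Qed.

Lemma bag_in_prefix t i m : i < m ->
  ((bag t i).1 \in prefix_labels t m) && ((bag t i).2 \in prefix_labels t m).
Proof.
move=> im; have /andP[b1 b2] := mem_bag_labels (bag t i).
by apply/andP; split; apply/flatten_mapP; exists i; rewrite // mem_iota.
Qed.

Lemma mem_iota1_pred i m : (i \in iota 1 m.-1) = (0 < i < m).
Proof. by rewrite mem_iota add1n; case: m => //; rewrite ltnS; case: i. Qed.

Section WellFormed.
Variables (k : nat) (t : bag_tree).
Hypothesis wft : well_formed k t.

Lemma parent_lt i : 0 < i < size t -> parent t i < i.
Proof. by rewrite -mem_iota1_pred; case/andP: wft => _ /allP; apply. Qed.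

Lemma bag_lt i : i < size t -> ((bag t i).1 < k) && ((bag t i).2 < k).
Proof.
by move/(bag_in_prefix t); case/andP: wft => pl _; rewrite !(perm_mem pl) !mem_iota.
Qed.

Lemma prefix_disjoint m l : m < size t -> l \in prefix_labels t m ->
  l \notin bag_labels (bag t m).
Proof.
move=> mt lm; case/andP: wft => pl _.
have : uniq (prefix_labels t (size t)) by rewrite (perm_uniq pl) iota_uniq.
have -> : prefix_labels t (size t) =
    prefix_labels t m.+1 ++
      flatten [seq bag_labels (bag t i) | i <- iota m.+1 (size t - m.+1)].
  by rewrite /prefix_labels -flatten_cat -map_cat -iotaD subnKC.
rewrite cat_uniq prefix_labelsS cat_uniq => /andP[/and3P[_ /hasPn disj _] _].
by apply/negP => /disj /negP.
Qed.

Lemma size_well_formed : 0 < k -> 0 < size t.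
Proof.
case/andP: wft => pl _; rewrite -(size_iota 0 k) -(perm_size pl).
by rewrite /prefix_labels; case: (size t).
Qed.

Lemma links_lt e : e \in links t -> (e.1 < k) && (e.2 < k).
Proof.
rewrite mem_cat => /orP[] /flatten_mapP[i]; rewrite ?mem_iota1_pred ?mem_iota.
  by rewrite /inner_links => it; case: ifP => // _; rewrite inE => /eqP ->;
    apply: bag_lt.
move=> hi; have /andP[_ it] := hi; have /andP[b1 b2] := bag_lt it.
have /andP[c1 c2] := bag_lt (ltn_trans (parent_lt hi) it).
by rewrite !inE => /or4P[] /eqP->; rewrite /= ?b1 ?b2 ?c1 ?c2.
Qed.

Lemma oriented_links_in v :
  all (fun e => (e.1 \in iota 0 k) && (e.2 \in iota 0 k)) (map (orient v) (links t)).
Proof.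
apply/allP => _ /mapP[e /links_lt/andP[e1 e2] ->].
by rewrite /orient !mem_iota /= !add0n; case: ifP; rewrite /= e1 e2.
Qed.

End WellFormed.

(** * Relaxed counts *)

Definition respects (tau : seq nat) t (y f : nat -> nat) :=
  all (fun e => f e.1 < f e.2) (x_edges t) &&
  all (fun e => y (f e.1) < y (f e.2)) (y_edges tau t).

Definition relaxed_count k n tau t (pi : 'S_n) : nat :=
  \sum_(f : {ffun 'I_k -> 'I_n}) respects tau t (extend pi) (extend f).

Lemma reach_lt (g : nat -> nat) E m a b : all (fun e => g e.1 < g e.2) E ->
  reach m E a b -> g a < g b.
Proof.
move=> /allP gE; elim: m a => //= m IH a /hasP[e eE].
case: eqP => // <-; case: eqP => [<- _|_ /IH]; first exact: gE.
by apply: ltn_trans; apply: gE.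
Qed.

Lemma separated_respects_inj k tau t (y f : nat -> nat) :
  separated k tau t -> respects tau t y f -> {in iota 0 k &, injective f}.
Proof.
move=> sep /andP[fX fY] a b ak bk fab; apply/eqP; move: a b ak bk fab.
suff lt_neq a b : a \in iota 0 k -> b < a -> f a <> f b.
  move=> a b ak bk fab; case: ltngtP => // ab; last by case: (lt_neq a b ak ab).
  by case: (lt_neq b a bk ab).
move=> ak ba fab; have := allP (allP sep a ak) b; rewrite mem_iota => /(_ ba).
case: ifP => [/(reach_lt fX)|_]; first by rewrite fab ltnn.
case: ifP => [/(reach_lt (g := y \o f) fY)|_ /(reach_lt (g := y \o f) fY)];
  by rewrite /= fab ltnn.
Qed.

Lemma extend_comp_injective k n (pi : 'S_n) (f : {ffun 'I_k -> 'I_n}) :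
  injective f -> {in iota 0 k &, injective (extend pi \o extend f)}.
Proof.
move=> f_inj a b; rewrite !mem_iota /= !add0n => ak bk.
rewrite -[a]/(val (Ordinal ak)) -[b]/(val (Ordinal bk)) !extendE.
by move=> /val_inj/perm_inj/f_inj->.
Qed.

Lemma respects_count k n tau t (pi : 'S_n) (f : {ffun 'I_k -> 'I_n}) :
  well_formed k t -> separated k tau t ->
  respects tau t (extend pi) (extend f) =
  count (increasing (extend f)) (linear_extensions (x_edges t) (iota 0 k)) *
  count (increasing (extend pi \o extend f))
    (linear_extensions (y_edges tau t) (iota 0 k))
  :> nat.
Proof.
move=> wft sep; have [/injectiveP f_inj|not_inj] := boolP (injectiveb f).
  rewrite !count_increasing_linear_extensions ?iota_uniq ?oriented_links_in ?mulnb //.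
    exact: extend_comp_injective.
  exact/extend_injP.
have /negPf -> : ~~ respects tau t (extend pi) (extend f).
  apply: contra not_inj => /(separated_respects_inj sep) inj.
  exact/injectiveP/extend_injP.
set exts := linear_extensions (x_edges t) _.
suff -> : count (increasing (extend f)) exts = 0 by [].
apply/eqP; rewrite -leqn0 leqNgt -has_count.
apply: contra not_inj => /hasP[X /perm_linear_extension pX incX].
by apply/injectiveP/extend_injP => a b; rewrite -!(perm_mem pX);
  apply: increasing_inj.
Qed.

Lemma relaxed_countE k n tau t (pi : 'S_n) : well_formed k t -> separated k tau t ->
  relaxed_count k tau t pi =
  \sum_(s <- patterns k tau t) one_line_pattern_count k pi s.
Proof.
move=> wft sep; rewrite /relaxed_count /patterns big_allpairs_dep /=.
under eq_bigr => f _ do rewrite respects_count // -!sum1_count big_mkcond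
  [X in _ * X]big_mkcond big_distrlr /=.
rewrite exchange_big; apply: eq_big_seq => X /perm_linear_extension pX.
rewrite exchange_big; apply: eq_big_seq => Y /perm_linear_extension pY.
rewrite -sum_increasing_pair //; apply: eq_bigr => f _.
by case: increasing; case: increasing.
Qed.

(** * Eliminating the bags of a tree *)

Definition agree (u v a b : nat) := if u < v then a < b else b < a.

Definition link_ok (tau : seq nat) (y : nat -> nat) (e : nat * nat) (p q : nat) :=
  agree e.1 e.2 p q && agree (nth 0 tau e.1) (nth 0 tau e.2) (y p) (y q).

Definition bag_ok tau y (b : nat * nat) p q :=
  if b.1 == b.2 then p == q else link_ok tau y b p q.

Definition cross_ok tau y (b c : nat * nat) r s p q :=
  [&& link_ok tau y (b.1, c.1) r p, link_ok tau y (b.1, c.2) r q,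
      link_ok tau y (b.2, c.1) s p & link_ok tau y (b.2, c.2) s q].

Lemma respectsE tau t y f :
  respects tau t y f = all (fun e => link_ok tau y e (f e.1) (f e.2)) (links t).
Proof.
rewrite /respects !all_map -all_predI; apply: eq_all => e /=.
by rewrite /link_ok /agree /orient /=; congr (_ && _); case: ifP.
Qed.

Lemma all_flatten (T : Type) (P : pred T) (ss : seq (seq T)) :
  all P (flatten ss) = all (all P) ss.
Proof. by elim: ss => //= s ss IH; rewrite all_cat IH. Qed.

Lemma natr_all (R : comNzRingType) (T : Type) (P : pred T) (s : seq T) :
  ((all P s)%:R = \prod_(b <- s) (P b)%:R :> R)%R.
Proof.
elim: s => [|b s IH]; first by rewrite big_nil.
by rewrite big_cons -IH /= -mulnb natrM.
Qed.

Section IteratedSums.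
Local Open Scope ring_scope.
Variables (R : comNzRingType) (n : nat).
Implicit Types (ls : seq nat) (e f : nat -> nat) (F G : (nat -> nat) -> R).

Fixpoint sum_over ls e F : R :=
  if ls is l :: ls' then \sum_(x < n) sum_over ls' (upd e l x) F else F e.

Lemma sum_over_cat ls1 ls2 e F :
  sum_over (ls1 ++ ls2) e F = sum_over ls1 e (fun f => sum_over ls2 f F).
Proof. by elim: ls1 e => //= l ls1 IH e; apply: eq_bigr => x _; apply: IH. Qed.

Lemma eq_sum_over ls e F G :
  (forall f, (forall l, l \notin ls -> f l = e l) -> F f = G f) ->
  sum_over ls e F = sum_over ls e G.
Proof.
elim: ls e => [|l ls IH] e FG /=; first exact: FG.
apply: eq_bigr => x _; apply: IH => f fe; apply: FG => j.
by rewrite inE negb_or => /andP[jl js]; rewrite fe // /upd (negPf jl).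
Qed.

Lemma sum_overZ ls e c F : sum_over ls e (fun f => c * F f) = c * sum_over ls e F.
Proof.
by elim: ls e => //= l ls IH e; rewrite mulr_sumr; apply: eq_bigr => x _; apply: IH.
Qed.

Lemma sum_over_ffun k ls e F :
  uniq ls -> all (fun l => l < k)%N ls ->
  (forall l, (l < k)%N -> l \notin ls -> (e l < n)%N) ->
  (forall f g, {in iota 0 k, f =1 g} -> F f = F g) ->
  sum_over ls e F =
  \sum_(f : {ffun 'I_k -> 'I_n} |
      [forall j : 'I_k, (val j \in ls) || (val (f j) == e j)]) F (extend f).
Proof.
move=> + + + extF; elim: ls e => [|l ls IH] e /=.
  move=> _ _ e_lt; have e_lt' (j : 'I_k) : (e j < n)%N by apply: e_lt.
  rewrite (big_pred1 [ffun j => Ordinal (e_lt' j)]) => [|f].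
    apply: extF => j; rewrite mem_iota /= => jk.
    by rewrite -[j]/(val (Ordinal jk)) extendE ffunE.
  apply/forallP/eqP => [fe|-> j]; last by rewrite ffunE eqxx.
  by apply/ffunP => j; rewrite ffunE; apply: val_inj; apply/eqP; apply: fe.
move=> /andP[l_ls uls] /andP[lk ls_lt] e_lt.
rewrite (partition_big (fun f : {ffun 'I_k -> 'I_n} => f (Ordinal lk)) predT) //=.
apply: eq_bigr => x _; rewrite IH // => [|j jk j_ls]; last first.
  by rewrite /upd; case: eqP => // /eqP jl; apply: e_lt; rewrite // inE negb_or jl.
apply: eq_bigl => f; apply/forallP/andP => [fe|[/forallP fe /eqP fx] j].
  split; last by have := fe (Ordinal lk); rewrite /= (negPf l_ls) /upd eqxx.
  by apply/forallP => j; have := fe j; rewrite inE /upd; case: (val j == l).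
have := fe j; rewrite inE /upd; case: eqP => [jl _|//].
by apply/orP; right; rewrite -fx; apply/eqP; congr (val (f _)); apply: val_inj.
Qed.

Lemma sum_over_all k ls e F : perm_eq ls (iota 0 k) ->
  (forall f g, {in iota 0 k, f =1 g} -> F f = F g) ->
  sum_over ls e F = \sum_(f : {ffun 'I_k -> 'I_n}) F (extend f).
Proof.
move=> pls extF; rewrite (@sum_over_ffun k) ?(perm_uniq pls) ?iota_uniq //.
- by apply: eq_bigl => f; apply/forallP => j;
  rewrite (perm_mem pls) mem_iota /= add0n ltn_ord.
- by apply/allP => l; rewrite (perm_mem pls) mem_iota.
- by move=> l lk; rewrite (perm_mem pls) mem_iota /= lk.
Qed.

End IteratedSums.

Section Elimination.
Local Open Scope ring_scope.
Variables (R : comNzRingType) (n k : nat).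
Variables (tau : seq nat) (y : nat -> nat) (t : bag_tree).
Hypothesis wft : well_formed k t.
Implicit Types (A : nat -> nat -> nat -> R) (B : nat -> nat -> R) (f g : nat -> nat).

Definition edge_factor i f : R :=
  let b := bag t i in let c := bag t (parent t i) in
  (cross_ok tau y b c (f b.1) (f b.2) (f c.1) (f c.2))%:R.

Definition weight A m f : R :=
  (\prod_(i < m) A i (f (bag t i).1) (f (bag t i).2)) *
  \prod_(1 <= i < m) edge_factor i f.

Definition total A m : R := sum_over n (prefix_labels t m) (fun=> 0%N) (weight A m).

Definition aggregate i B p q : R :=
  \sum_(r < n) \sum_(s < n)
    (cross_ok tau y (bag t i) (bag t (parent t i)) r s p q)%:R * B r s.

Definition absorb A m i p q : R :=
  if i == parent t m then A i p q * aggregate m (A m) p q else A i p q.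

Definition supported A := forall i p q, (i < size t)%N ->
  ~~ bag_ok tau y (bag t i) p q -> A i p q = 0.

Lemma absorb_supported A m : supported A -> supported (absorb A m).
Proof.
by move=> suppA i p q it nb; rewrite /absorb; case: ifP => _; rewrite suppA // mul0r.
Qed.

Lemma sum_over_bag i B (c : nat -> nat -> R) e :
  (forall p q, ~~ bag_ok tau y (bag t i) p q -> B p q = 0) ->
  sum_over n (bag_labels (bag t i)) e
    (fun f => c (f (bag t i).1) (f (bag t i).2) * B (f (bag t i).1) (f (bag t i).2)) =
  \sum_(r < n) \sum_(s < n) c r s * B r s.
Proof.
rewrite /bag_labels /bag_ok; case: eqP => [<-|/eqP ab] suppB /=; last first.
  by apply: eq_bigr => r _; apply: eq_bigr => s _; rewrite /upd !eqxx (negPf ab).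
apply: eq_bigr => r _; rewrite /upd eqxx (bigD1 r) //= big1 ?addr0 // => s sr.
by rewrite suppB ?mulr0 // eq_sym.
Qed.

Lemma eq_weight A m f g : (m <= size t)%N ->
  {in prefix_labels t m, f =1 g} -> weight A m f = weight A m g.
Proof.
move=> mt fg; have eq_bag i : (i < m)%N ->
    f (bag t i).1 = g (bag t i).1 /\ f (bag t i).2 = g (bag t i).2.
  by move=> /(bag_in_prefix t)/andP[b1 b2]; rewrite !fg.
congr (_ * _); first by apply: eq_bigr => i _; have [-> ->] := eq_bag i (ltn_ord i).
apply: eq_big_nat => i /andP[i0 im]; have [e1 e2] := eq_bag i im.
have lt_it : (0 < i < size t)%N by rewrite i0 (leq_trans im).
have [e3 e4] := eq_bag _ (ltn_trans (parent_lt wft lt_it) im).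
by rewrite /edge_factor e1 e2 e3 e4.
Qed.

Lemma weightS A m f : (0 < m)%N ->
  weight A m.+1 f =
  weight A m f * (edge_factor m f * A m (f (bag t m).1) (f (bag t m).2)).
Proof. by move=> m0; rewrite /weight big_ord_recr big_nat_recr //=; ring. Qed.

Lemma weight_absorb A m f : (0 < m < size t)%N ->
  let c := bag t (parent t m) in
  weight (absorb A m) m f = weight A m f * aggregate m (A m) (f c.1) (f c.2).
Proof.
move=> /(parent_lt wft) pm c; rewrite /weight mulrAC; congr (_ * _).
rewrite (bigD1 (Ordinal pm)) //= [X in _ = X * _](bigD1 (Ordinal pm)) //= mulrAC.
rewrite /absorb eqxx; congr (_ * _); apply: eq_bigr => i ne_i.
by rewrite ifN.
Qed.

Lemma totalS A m : (0 < m < size t)%N -> supported A ->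
  total A m.+1 = total (absorb A m) m.
Proof.
move=> hm suppA; have /andP[m0 mt] := hm.
set b := bag t m; set c := bag t (parent t m).
rewrite /total prefix_labelsS sum_over_cat; apply: eq_sum_over => e _.
transitivity (sum_over n (bag_labels b) e (fun f => weight A m e *
    ((cross_ok tau y b c (f b.1) (f b.2) (e c.1) (e c.2))%:R * A m (f b.1) (f b.2)))).
  apply: eq_sum_over => f fe; have {}fe : {in prefix_labels t m, f =1 e}.
    by move=> l /(prefix_disjoint wft mt)/fe.
  rewrite weightS // (eq_weight _ (ltnW mt) fe) /edge_factor -/b -/c.
  by have /andP[c1 c2] := bag_in_prefix t (parent_lt wft hm);
    rewrite (fe c.1) ?(fe c.2).
rewrite sum_overZ (sum_over_bag (i := m)
  (fun r s => (cross_ok tau y b c r s (e c.1) (e c.2))%:R)) => [|p q].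
  by rewrite weight_absorb.
exact: suppA.
Qed.

Lemma total1 A : (0 < size t)%N -> supported A ->
  total A 1 = \sum_(r < n) \sum_(s < n) A 0 r s.
Proof.
move=> t0 suppA; rewrite /total prefix_labelsS /=.
transitivity (sum_over n (bag_labels (bag t 0)) (fun=> 0%N)
    (fun f => 1 * A 0 (f (bag t 0).1) (f (bag t 0).2))).
  apply: eq_sum_over => f _.
  by rewrite /weight big_ord_recr big_ord0 big_geq // mulr1.
rewrite (sum_over_bag (i := 0) (fun _ _ => 1)) => [|p q]; last exact: suppA.
by apply: eq_bigr => r _; apply: eq_bigr => s _; rewrite mul1r.
Qed.

Definition bag_indicator i p q : R := (bag_ok tau y (bag t i) p q)%:R.

Lemma bag_indicator_supported : supported bag_indicator.
Proof. by move=> i p q _ /negPf; rewrite /bag_indicator => ->. Qed.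

Lemma weight_bag_indicator f :
  weight bag_indicator (size t) f = (respects tau t y f)%:R.
Proof.
rewrite respectsE /links all_cat -mulnb natrM !all_flatten !all_map !natr_all.
congr (_ * _).
  rewrite -(big_mkord xpredT
    (fun i => bag_indicator i (f (bag t i).1) (f (bag t i).2))).
  rewrite /index_iota subn0; apply: eq_bigr => i _.
  rewrite /bag_indicator /bag_ok /inner_links /=; congr (nat_of_bool _)%:R.
  by case: eqP => [->|_] /=; rewrite ?eqxx ?andbT.
rewrite /index_iota subn1; apply: eq_bigr => i _.
by rewrite /edge_factor /cross_ok /= andbT.
Qed.

End Elimination.

Lemma total_bag_indicator (R : comNzRingType) k n tau t (pi : 'S_n) :
  well_formed k t ->
  (total n tau (extend pi) t (bag_indicator R tau (extend pi) t) (size t) =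
   (relaxed_count k tau t pi)%:R)%R.
Proof.
move=> wft; have /andP[pl _] := wft.
rewrite /total (sum_over_all _ _ pl) => [|f g fg].
  by rewrite natr_sum; apply: eq_bigr => f _; apply: weight_bag_indicator.
by apply: (@eq_weight R _ _ _ _ wft) => // l; rewrite (perm_mem pl); apply: fg.
Qed.

(** * Boxes as signed sums of quarter-planes *)

Inductive threshold := AtZero | AtEnd | AtP | AfterP | AtQ | AfterQ.

Definition threshold_value n p q t :=
  match t with
  | AtZero => 0 | AtEnd => n | AtP => p | AfterP => p.+1 | AtQ => q | AfterQ => q.+1
  end.

Lemma threshold_value_le n p q t : p < n -> q < n -> threshold_value n p q t <= n.
Proof. by case: t => //= /ltnW // _ /ltnW. Qed.

(* [u] and [v] are the ranks of the parent's labels placed at [p] and [q], [l]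
   that of the point to be placed in [[lower, upper)]. *)
Definition lower u v l :=
  if u < l then if (l < v) || (v < u) then AfterP else AfterQ
  else if v < l then AfterQ else AtZero.
Definition upper u v l :=
  if l < u then if (v < l) || (u < v) then AtP else AtQ
  else if l < v then AtQ else AtEnd.

Definition below (y : nat -> nat) a c r := (r < a) && (y r < c).

Definition side u v l := [:: (false, upper u v l); (true, lower u v l)].
Definition quarters (tau : seq nat) (c : nat * nat) l :
  seq (bool * (threshold * threshold)) :=
  let h := nth 0 tau in
  [seq (s.1 (+) s'.1, (s.2, s'.2)) | s <- side c.1 c.2 l,
    s' <- side (h c.1) (h c.2) (h l)].

Definition corner : Type :=
  (bool * (threshold * threshold)) * (bool * (threshold * threshold)).
Definition corner_sign (s : corner) := s.1.1 (+) s.2.1.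
Definition corners tau (b c : nat * nat) : seq corner :=
  [seq (s, s') | s <- quarters tau c b.1, s' <- quarters tau c b.2].

Lemma interval_agree n u v l p q z : p < n -> q < n -> z < n -> l != u -> l != v ->
  (if u == v then p == q else agree u v p q) ->
  let lo := threshold_value n p q (lower u v l) in
  let hi := threshold_value n p q (upper u v l) in
  (lo <= hi) /\ (lo <= z < hi) = agree l u z p && agree l v z q.
Proof.
move=> pn qn zn /eqP lu /eqP lv; rewrite /agree /lower /upper.
case: eqP => [uv /eqP pq|uv].
  subst v q; rewrite ltnn !orbF andbb.
  by case: (ltngtP u l) lu => // ul _ /=; split; lia.
by case: (ltngtP u l) lu => // ul lu; case: (ltngtP v l) lv => // vl lv;
  case: (ltngtP u v) uv => // uv _ pq /=; split; lia.
Qed.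

Section Corners.
Local Open Scope ring_scope.
Variables (R : comNzRingType) (n : nat) (tau : seq nat) (y : nat -> nat).
Hypothesis y_lt : forall r, (r < n -> y r < n)%N.
Implicit Type B : nat -> nat -> R.
Local Notation h := (nth 0%N tau).

Lemma natr_interval (lo hi z : nat) : (lo <= hi)%N ->
  ((lo <= z < hi)%N)%:R = (z < hi)%:R - (z < lo)%:R :> R.
Proof.
move=> lohi; case: (ltnP z lo) => zl /=; last by rewrite subr0.
by rewrite (leq_trans zl lohi) subrr.
Qed.

Lemma side_sum u v l p q z : (p < n)%N -> (q < n)%N -> (z < n)%N ->
  l != u -> l != v ->
  (if u == v then p == q else agree u v p q) ->
  \sum_(s <- side u v l) (-1) ^+ s.1 * (z < threshold_value n p q s.2)%N%:R =
  (agree l u z p && agree l v z q)%:R :> R.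
Proof.
move=> pn qn zn lu lv uv; have [lohi <-] := interval_agree pn qn zn lu lv uv.
by rewrite natr_interval // !big_cons big_nil addr0 expr0 mul1r expr1 mulN1r.
Qed.

Definition quadrant a c b d B : R :=
  \sum_(r < n) \sum_(s < n) (below y a c r && below y b d s)%:R * B r s.

Definition corner_quadrant (k : corner) B p q : R :=
  let x := threshold_value n p q in let z := threshold_value n (y p) (y q) in
  quadrant (x k.1.2.1) (z k.1.2.2) (x k.2.2.1) (z k.2.2.2) B.

Section Parent.
Variables (c : nat * nat) (p q : nat).
Hypotheses (pn : (p < n)%N) (qn : (q < n)%N).
Hypotheses (c_inj : c.1 != c.2 -> h c.1 != h c.2) (c_ok : bag_ok tau y c p q).

Definition avoids l := [&& l != c.1, l != c.2, h l != h c.1 & h l != h c.2].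

Lemma quarters_sum l r : (r < n)%N -> avoids l ->
  \sum_(s <- quarters tau c l) (-1) ^+ s.1 *
    (below y (threshold_value n p q s.2.1)
       (threshold_value n (y p) (y q) s.2.2) r)%:R =
  (link_ok tau y (l, c.1) r p && link_ok tau y (l, c.2) r q)%:R :> R.
Proof.
move=> rn /and4P[l1 l2 h1 h2].
have x_ok : if c.1 == c.2 then p == q else agree c.1 c.2 p q.
  by move: c_ok; rewrite /bag_ok; case: eqP => // _ /andP[].
have y_ok : if h c.1 == h c.2 then y p == y q else agree (h c.1) (h c.2) (y p) (y q).
  move: c_ok; rewrite /bag_ok; case: (eqVneq c.1 c.2) => [->|/c_inj ne].
    by rewrite eqxx => /eqP->.
  by rewrite (negPf ne) => /andP[].
rewrite /link_ok /= andbACA -mulnb natrM.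
rewrite -(side_sum pn qn rn l1 l2 x_ok).
rewrite -(side_sum (y_lt pn) (y_lt qn) (y_lt rn) h1 h2 y_ok).
rewrite big_distrlr big_allpairs_dep /=.
apply: eq_bigr => s _; apply: eq_bigr => s' _.
by rewrite /below -mulnb natrM signr_addb; ring.
Qed.

Lemma corners_sum (b : nat * nat) B : avoids b.1 -> avoids b.2 ->
  \sum_(r < n) \sum_(s < n) (cross_ok tau y b c r s p q)%:R * B r s =
  \sum_(k <- corners tau b c) (-1) ^+ corner_sign k * corner_quadrant k B p q.
Proof.
move=> b1 b2.
under [RHS]eq_bigr => k _ do rewrite /corner_quadrant /quadrant mulr_sumr.
rewrite [RHS]exchange_big; apply: eq_bigr => r _.
under [RHS]eq_bigr => k _ do rewrite mulr_sumr.
rewrite [RHS]exchange_big; apply: eq_bigr => s _.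
have -> : cross_ok tau y b c r s p q =
    (link_ok tau y (b.1, c.1) r p && link_ok tau y (b.1, c.2) r q) &&
    (link_ok tau y (b.2, c.1) s p && link_ok tau y (b.2, c.2) s q).
  by rewrite /cross_ok !andbA.
rewrite -mulnb natrM -!quarters_sum // big_distrlr mulr_suml [RHS]big_allpairs_dep /=.
apply: eq_bigr => k _; rewrite mulr_suml; apply: eq_bigr => k' _.
by rewrite -mulnb natrM /corner_sign signr_addb; ring.
Qed.

End Parent.
End Corners.

(** * Quarter-planes as sums over dyadic squares *)

Definition digit i a := (a %/ 2 ^ i) %% 2.
Definition twin i a := (a %/ 2 ^ i) %/ 2 * 2.
Definition hit i a r : nat := digit i a * (r %/ 2 ^ i == twin i a).

Lemma twin_le i a : twin i a <= a.
Proof. by rewrite /twin (leq_trans (leq_trunc_div _ _)) // leq_div. Qed.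

(* [r < a] iff, at the highest bit where they differ, [a] has a one. *)
Lemma sum_hit L a r : a < 2 ^ L -> \sum_(i < L) hit i a r = (r < a).
Proof.
move=> aL.
suff sum_hit_m m : \sum_(i < m) hit i a r + (r %/ 2 ^ m < a %/ 2 ^ m) = (r < a).
  by rewrite -(sum_hit_m L) [a %/ _]divn_small // ltn0 addn0.
elim: m => [|m IH]; first by rewrite big_ord0 expn0 !divn1.
rewrite -IH big_ord_recr /= -addnA; congr addn.
rewrite /hit /digit /twin expnSr !divnMA; set u := r %/ _; set v := a %/ _.
have := divn_eq u 2; have := divn_eq v 2.
have := @ltn_pmod u 2 isT; have := @ltn_pmod v 2 isT.
move: (u %/ 2) (v %/ 2) (u %% 2) (v %% 2) => u2 v2 bu bv.
case: bv => [|[|//]] _; case: bu => [|[|//]] _ -> ->; lia.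
Qed.

Section DyadicLevels.
Local Open Scope ring_scope.
Variables (R : comNzRingType) (n : nat) (y : nat -> nat).
Hypothesis y_lt : forall r, (r < n -> y r < n)%N.
Implicit Type B : nat -> nat -> R.

Definition square_hit i j a c r : nat := (hit i a r * hit j c (y r))%N.

Lemma sum_square_hit L a c r : (a < 2 ^ L)%N -> (c < 2 ^ L)%N ->
  (\sum_(i < L) \sum_(j < L) square_hit i j a c r)%N = below y a c r.
Proof. by move=> aL cL; rewrite -big_distrlr /= !sum_hit // mulnb. Qed.

Definition level i j i' j' a c b d B : R :=
  \sum_(r < n) \sum_(s < n)
    (square_hit i j a c r * square_hit i' j' b d s)%N%:R * B r s.

Lemma quadrant_levels L a c b d B :
  (a < 2 ^ L)%N -> (c < 2 ^ L)%N -> (b < 2 ^ L)%N -> (d < 2 ^ L)%N ->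
  quadrant n y a c b d B =
  \sum_(i < L) \sum_(j < L) \sum_(i' < L) \sum_(j' < L) level i j i' j' a c b d B.
Proof.
move=> aL cL bL dL; rewrite /level.
under [RHS]eq_bigr => i _ do under eq_bigr => j _ do under eq_bigr => i' _ do
  (rewrite exchange_big /=; under eq_bigr => r _ do rewrite exchange_big /=).
under [RHS]eq_bigr => i _ do under eq_bigr => j _ do
  (rewrite exchange_big /=; under eq_bigr => r _ do rewrite exchange_big /=).
under [RHS]eq_bigr => i _ do
  (rewrite exchange_big /=; under eq_bigr => r _ do rewrite exchange_big /=).
rewrite [RHS]exchange_big; apply: eq_bigr => r _.
rewrite [RHS]exchange_big; apply: eq_bigr => s _.
rewrite -mulnb -(sum_square_hit r aL cL) -(sum_square_hit s bL dL).
rewrite big_distrl natr_sum mulr_suml /=; apply: eq_bigr => i _.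
rewrite big_distrl natr_sum mulr_suml /=; apply: eq_bigr => j _.
rewrite big_distrr natr_sum mulr_suml /=; apply: eq_bigr => i' _.
by rewrite big_distrr natr_sum mulr_suml.
Qed.

Definition class_of i j r : nat * nat := (r %/ 2 ^ i, y r %/ 2 ^ j)%N.

(* [I X Y] is one plus some point of the class [(X, Y)], or 0 if it is empty; this
   numbers the at most [n] nonempty classes by [1, ..., n]. *)
Definition numbering i j (I : nat -> nat -> nat) m :=
  forall X Y, (X <= n)%N -> (Y <= n)%N ->
  if I X Y is r.+1 then (r < m)%N && (class_of i j r == (X, Y))
  else forall r, (r < m)%N -> class_of i j r != (X, Y).

Lemma numbering_le i j I X Y : numbering i j I n -> (X <= n)%N -> (Y <= n)%N ->
  (I X Y <= n)%N.
Proof.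
by move=> numI Xn Yn; have := numI X Y Xn Yn; case: (I X Y) => // r /andP[].
Qed.

Lemma class_of_le i j r : (r < n)%N ->
  ((class_of i j r).1 <= n)%N && ((class_of i j r).2 <= n)%N.
Proof. by move=> rn; rewrite !(leq_trans (leq_div _ _)) // ltnW // y_lt. Qed.

Lemma numbering_eq i j I r X Y :
  numbering i j I n -> (r < n)%N -> (X <= n)%N -> (Y <= n)%N ->
  (I (class_of i j r).1 (class_of i j r).2 == I X Y) = (class_of i j r == (X, Y)).
Proof.
move=> numI rn Xn Yn; have /andP[x_le y_le] := class_of_le i j rn.
apply/eqP/eqP => [eI|-> //]; have := numI _ _ x_le y_le; have := numI _ _ Xn Yn.
rewrite eI -surjective_pairing.
case: (I X Y) => [_ /(_ r rn)|u]; first by rewrite eqxx.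
by case/andP=> _ /eqP-> /andP[_ /eqP].
Qed.

Definition bucket i j i' j' (I I' : nat -> nat -> nat) B N M : R :=
  \sum_(r < n) \sum_(s < n)
    ((I (class_of i j r).1 (class_of i j r).2 == N) &&
     (I' (class_of i' j' s).1 (class_of i' j' s).2 == M))%:R * B r s.

Lemma level_bucket i j i' j' I I' a c b d B :
  numbering i j I n -> numbering i' j' I' n ->
  (a <= n)%N -> (c <= n)%N -> (b <= n)%N -> (d <= n)%N ->
  level i j i' j' a c b d B =
  (digit i a * digit j c * (digit i' b * digit j' d))%N%:R *
  bucket i j i' j' I I' B (I (twin i a) (twin j c)) (I' (twin i' b) (twin j' d)).
Proof.
move=> numI numI' an cn bn dn; rewrite /level /bucket.
rewrite mulr_sumr; apply: eq_bigr => r _; rewrite mulr_sumr; apply: eq_bigr => s _.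
have twin_n i0 a0 : (a0 <= n -> twin i0 a0 <= n)%N.
  by apply: leq_trans; apply: twin_le.
rewrite !numbering_eq ?twin_n // !xpair_eqE -!mulnb /square_hit /hit !natrM; ring.
Qed.

End DyadicLevels.

(** * A structured language and its compilation *)

(* [Cells] stands for [0, ..., n]: thresholds and class numbers take these [n + 1]
   values and serve as table indices. *)
Inductive range := Points | Cells | Bits.

Inductive expr :=
  | Lit of nat
  | Size of range
  | Var of nat
  | Op of binop & expr & expr
  | Get of nat & expr & expr.

Inductive cmd :=
  | Assign of nat & expr
  | Put of nat & expr & expr & expr
  | Skip
  | Seq of cmd & cmd
  | For of nat & range & cmd.

Record store := Store { var : nat -> nat; tab : nat -> nat -> nat -> nat }.

Definition set_var s v x := Store (upd (var s) v x) (tab s).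
Definition set_cell s t x y v :=
  Store (var s) (fun t' x' y' =>
    if [&& t' == t, x' == x & y' == y] then v else tab s t' x' y').

Fixpoint expr_table_count (e : expr) : nat :=
  match e with
  | Op _ e1 e2 => maxn (expr_table_count e1) (expr_table_count e2)
  | Get t e1 e2 => maxn t.+1 (maxn (expr_table_count e1) (expr_table_count e2))
  | _ => 0
  end.

Fixpoint table_count (c : cmd) : nat :=
  match c with
  | Assign _ e => expr_table_count e
  | Put t e1 e2 e =>
      maxn t.+1 (maxn (expr_table_count e1)
                   (maxn (expr_table_count e2) (expr_table_count e)))
  | Skip => 0
  | Seq c1 c2 => maxn (table_count c1) (table_count c2)
  | For _ _ c => table_count c
  end.

Section Semantics.
Variables (w n L : nat).
Local Notation D := n.+1.

Definition range_size r := match r with Points => n | Cells => D | Bits => L end.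

(* Reducing the indices modulo [D] makes every access legal. *)
Fixpoint eval s (e : expr) : nat :=
  match e with
  | Lit c => c %% 2 ^ w
  | Size r => range_size r
  | Var v => var s v
  | Op o e1 e2 => eval_binop w o (eval s e1) (eval s e2)
  | Get t e1 e2 => tab s t (eval s e1 %% D) (eval s e2 %% D)
  end.

Fixpoint exec (c : cmd) s : store :=
  match c with
  | Assign v e => set_var s v (eval s e)
  | Put t e1 e2 e => set_cell s t (eval s e1 %% D) (eval s e2 %% D) (eval s e)
  | Skip => s
  | Seq c1 c2 => exec c2 (exec c1 s)
  | For v r c => iteri (range_size r) (fun k s' => exec c (set_var s' v k)) s
  end.

Fixpoint expr_cost (e : expr) : nat :=
  match e with
  | Lit _ | Size _ | Var _ => 1
  | Op _ e1 e2 => expr_cost e1 + expr_cost e2 + 1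
  | Get _ e1 e2 => expr_cost e1 + expr_cost e2 + 8
  end.

Fixpoint cost (c : cmd) : nat :=
  match c with
  | Assign _ e => expr_cost e + 1
  | Put _ e1 e2 e => expr_cost e1 + expr_cost e2 + 7 + expr_cost e + 1
  | Skip => 0
  | Seq c1 c2 => cost c1 + cost c2
  | For _ r c => range_size r * (cost c + 6) + 3
  end.

Lemma evalE s :
  (forall c, eval s (Lit c) = c %% 2 ^ w) *
  (forall r, eval s (Size r) = range_size r) *
  (forall v, eval s (Var v) = var s v) *
  (forall o e1 e2, eval s (Op o e1 e2) = eval_binop w o (eval s e1) (eval s e2)) *
  (forall t e1 e2, eval s (Get t e1 e2) = tab s t (eval s e1 %% D) (eval s e2 %% D)).
Proof. by []. Qed.

Lemma execE s :
  (forall v e, exec (Assign v e) s = set_var s v (eval s e)) *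
  (forall t e1 e2 e, exec (Put t e1 e2 e) s =
     set_cell s t (eval s e1 %% D) (eval s e2 %% D) (eval s e)) *
  (exec Skip s = s) *
  (forall c1 c2, exec (Seq c1 c2) s = exec c2 (exec c1 s)).
Proof. by []. Qed.

End Semantics.

Arguments eval : simpl never.
Arguments exec : simpl never.

(* Register 0 holds [n] from the start and register 1 serves as the table width
   [n + 1]; variables get the other odd registers and temporaries the even ones. *)
Definition range_reg r := match r with Points => 0 | Cells => 1 | Bits => 2 end.
Definition var_reg v := v.*2 + 3.
Definition tmp d := d.*2 + 4.

(* Turns the indices in [tmp d] and [tmp d.+1] into the address of a cell. *)
Definition address_code d t : program :=
  [:: Binop OpMod (tmp d) (tmp d) 1; Binop OpMod (tmp d.+1) (tmp d.+1) 1;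
      Const (tmp d.+2) t; Binop OpMul (tmp d.+2) (tmp d.+2) 1;
      Binop OpAdd (tmp d) (tmp d.+2) (tmp d); Binop OpMul (tmp d) (tmp d) 1;
      Binop OpAdd (tmp d) (tmp d) (tmp d.+1)].

Fixpoint compile_expr d (e : expr) : program :=
  match e with
  | Lit c => [:: Const (tmp d) c]
  | Size r => [:: Move (tmp d) (range_reg r)]
  | Var v => [:: Move (tmp d) (var_reg v)]
  | Op o e1 e2 =>
      compile_expr d e1 ++ compile_expr d.+1 e2 ++
      [:: Binop o (tmp d) (tmp d) (tmp d.+1)]
  | Get t e1 e2 =>
      compile_expr d e1 ++ compile_expr d.+1 e2 ++ address_code d t ++
      [:: LoadM (tmp d) (tmp d)]
  end.

Fixpoint compile base d (c : cmd) : program :=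
  match c with
  | Assign v e => compile_expr d e ++ [:: Move (var_reg v) (tmp d)]
  | Put t e1 e2 e =>
      compile_expr d e1 ++ compile_expr d.+1 e2 ++ address_code d t ++
      compile_expr d.+1 e ++ [:: StoreM (tmp d) (tmp d.+1)]
  | Skip => [::]
  | Seq c1 c2 =>
      let code := compile base d c1 in code ++ compile (base + size code) d c2
  | For v r c =>
      let body := compile (base + 4) d.+1 c in
      [:: Const (tmp d) 0; Binop OpLt (tmp d.+1) (tmp d) (range_reg r);
          JumpZ (tmp d.+1) (base + size body + 7); Move (var_reg v) (tmp d)] ++
      body ++
      [:: Const (tmp d.+1) 1; Binop OpAdd (tmp d) (tmp d) (tmp d.+1); Jump base.+1]
  end.

Lemma size_compile_expr d e : size (compile_expr d e) = expr_cost e.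
Proof.
by elim: e d => //= [o|t] e1 IH1 e2 IH2 d; rewrite !size_cat IH1 IH2 addnA.
Qed.

Lemma tmp_eq d d' : (tmp d == tmp d') = (d == d'). Proof. by rewrite /tmp; lia. Qed.
Lemma tmp_neq_var d v : (tmp d == var_reg v) = false.
Proof. by rewrite /tmp /var_reg; lia. Qed.
Lemma tmp_neq_range d r : (tmp d == range_reg r) = false.
Proof. by case: r => /=; rewrite /tmp; lia. Qed.
Lemma var_reg_eq v v' : (var_reg v == var_reg v') = (v == v').
Proof. by rewrite /var_reg; lia. Qed.
Lemma range_neq_var r v : (range_reg r == var_reg v) = false.
Proof. by case: r => /=; rewrite /var_reg; lia. Qed.

Section Machine.
Variables (w : nat) (p : program) (sp : nat).
Implicit Types (cs : program) (m : (nat -> nat) * (nat -> nat)).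

Definition runs S n S' :=
  iter n (step w p) S = S' /\
  forall i, i < n -> touched p (iter i (step w p) S) <= sp.

Lemma runs0 S : runs S 0 S. Proof. by []. Qed.

Lemma runs_trans S1 n1 S2 n2 S3 : runs S1 n1 S2 -> runs S2 n2 S3 ->
  runs S1 (n1 + n2) S3.
Proof.
move=> [e1 t1] [e2 t2]; split=> [|i i_lt]; first by rewrite addnC iterD e1.
case: (ltnP i n1) => [/t1 //|n1i].
by rewrite -(subnK n1i) iterD e1; apply: t2; rewrite ltn_subLR.
Qed.

Lemma runs_step S : touched p S <= sp -> runs S 1 (step w p S).
Proof. by move=> ht; split=> // -[]. Qed.

Definition code_at base cs :=
  forall j, j < size cs -> nth Halt p (base + j) = nth Halt cs j.

Lemma code_at_cat base cs1 cs2 :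
  code_at base (cs1 ++ cs2) -> code_at base cs1 /\ code_at (base + size cs1) cs2.
Proof.
move=> cat_at; split=> j js.
  by rewrite cat_at ?size_cat ?nth_cat ?js // ltn_addr.
by rewrite -addnA cat_at ?size_cat ?ltn_add2l // nth_cat ltnNge leq_addr /= addKn.
Qed.

Lemma code_at_cons base i cs :
  code_at base (i :: cs) -> nth Halt p base = i /\ code_at base.+1 cs.
Proof.
move=> cons_at; split; first by have := cons_at 0 isT; rewrite addn0.
by move=> j js; rewrite addSnnS cons_at.
Qed.

Definition straight i :=
  match i with Jump _ | JumpZ _ _ | Halt => false | _ => true end.

Definition effect m i :=
  let S := step w [:: i] (State 0 m.1 m.2) in (reg S, memory S).

Lemma effectE R M :
  (forall r c, effect (R, M) (Const r c) = (upd R r (c %% 2 ^ w), M)) *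
  (forall r r1, effect (R, M) (Move r r1) = (upd R r (R r1), M)) *
  (forall o r r1 r2,
     effect (R, M) (Binop o r r1 r2) = (upd R r (eval_binop w o (R r1) (R r2)), M)) *
  (forall r ra, effect (R, M) (LoadM r ra) = (upd R r (M (R ra)), M)) *
  (forall ra r, effect (R, M) (StoreM ra r) = (R, upd M (R ra) (R r))).
Proof. by []. Qed.

Definition effects := foldl effect.

Fixpoint safe m cs : bool :=
  if cs is i :: cs' then
    [&& straight i, touched [:: i] (State 0 m.1 m.2) <= sp & safe (effect m i) cs']
  else true.

Lemma effects_cat m cs1 cs2 : effects m (cs1 ++ cs2) = effects (effects m cs1) cs2.
Proof. exact: foldl_cat. Qed.

Lemma safe_cat m cs1 cs2 :
  safe m (cs1 ++ cs2) = safe m cs1 && safe (effects m cs1) cs2.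
Proof. by elim: cs1 m => //= i cs1 IH m; rewrite IH -!andbA. Qed.

Lemma runs_instr pc i R M R' M' : nth Halt p pc = i -> straight i ->
  touched [:: i] (State 0 R M) <= sp -> effect (R, M) i = (R', M') ->
  runs (State pc R M) 1 (State pc.+1 R' M').
Proof.
move=> i_at st_i acc_i eff_i.
have <- : step w p (State pc R M) = State pc.+1 R' M'.
  by case: eff_i; rewrite /step /fetch /= i_at; case: (i) st_i => //= *; subst.
by apply: runs_step; move: acc_i; rewrite /touched /fetch /= i_at.
Qed.

Lemma runs_straight base cs R M R' M' : code_at base cs -> safe (R, M) cs ->
  effects (R, M) cs = (R', M') ->
  runs (State base R M) (size cs) (State (base + size cs) R' M').
Proof.
elim: cs base R M => [|i cs IH] base R M.
  by move=> _ _ [-> ->]; rewrite addn0; apply: runs0.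
case/code_at_cons=> i_at cs_at /= /and3P[st_i acc_i].
case eff_i: (effect _ i) => [R1 M1] safe_cs eff_cs.
rewrite -add1n addnA addn1; apply: runs_trans (IH _ _ _ cs_at safe_cs eff_cs).
exact: runs_instr i_at st_i acc_i eff_i.
Qed.

Lemma runs_JumpZ pc R M r l : nth Halt p pc = JumpZ r l ->
  runs (State pc R M) 1 (State (if R r == 0 then l else pc.+1) R M).
Proof.
move=> pc_at; have := @runs_step (State pc R M).
by rewrite /touched /step /fetch /= pc_at; apply.
Qed.

Lemma runs_Jump pc R M l : nth Halt p pc = Jump l ->
  runs (State pc R M) 1 (State l R M).
Proof.
move=> pc_at; have := @runs_step (State pc R M).
by rewrite /touched /step /fetch /= pc_at; apply.
Qed.

End Machine.

Section Compilation.
Variables (w n L T sp : nat) (p : program).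
Local Notation D := n.+1.
Local Notation eval := (eval w n L).
Local Notation exec := (exec w n L).
Local Notation range_size := (range_size n L).
Local Notation effects := (effects w).
Local Notation safe := (safe w sp).
Hypothesis room : T * D * D <= 2 ^ w.
Hypothesis fits : T * D * D <= sp.
Hypothesis D_lt : D < 2 ^ w.
Hypothesis L_le : L <= n.
Implicit Types (m : (nat -> nat) * (nat -> nat)) (s : store).

Definition addr t x y := (t * D + x) * D + y.

Lemma addr_lt t x y : t < T -> x < D -> y < D -> addr t x y < T * D * D.
Proof. by rewrite /addr => tn xD yD; nia. Qed.

Lemma addr_inj t x y t' x' y' : x < D -> y < D -> x' < D -> y' < D ->
  addr t x y = addr t' x' y' -> [/\ t = t', x = x' & y = y'].
Proof.
move=> xD yD x'D y'D; rewrite /addr => eq_addr.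
have ey : y = y' by have := congr1 (modn^~ D) eq_addr; rewrite !modnMDl !modn_small.
subst y'; move/addIn: eq_addr => /eqP; rewrite eqn_pmul2r // => /eqP eq_row.
have ex : x = x' by have := congr1 (modn^~ D) eq_row; rewrite !modnMDl !modn_small.
by subst x'; move/addIn: eq_row => /eqP; rewrite eqn_pmul2r // => /eqP.
Qed.

Definition represents s (R M : nat -> nat) :=
  [/\ forall r, R (range_reg r) = range_size r,
      forall v, R (var_reg v) = var s v &
      forall t x y, t < T -> x < D -> y < D -> M (addr t x y) = tab s t x y].

Definition keeps d (R R' : nat -> nat) :=
  forall r, (forall d', d <= d' -> r == tmp d' = false) -> R' r = R r.

Lemma keeps_trans d R1 R2 R3 : keeps d R1 R2 -> keeps d R2 R3 -> keeps d R1 R3.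
Proof. by move=> k1 k2 r h; rewrite k2 ?k1. Qed.

Lemma keeps_weaken d d' R R' : d <= d' -> keeps d' R R' -> keeps d R R'.
Proof. by move=> dd' k r h; apply: k => e /(leq_trans dd')/h. Qed.

Lemma keeps_upd d d' R x : d <= d' -> keeps d R (upd R (tmp d') x).
Proof. by move=> dd' r h; rewrite /upd h. Qed.

Lemma keeps_tmp d d' R R' : keeps d R R' -> d' < d -> R' (tmp d') = R (tmp d').
Proof.
by move=> k d'd; apply: k => e de; rewrite tmp_eq ltn_eqF // (leq_trans d'd).
Qed.

Lemma keeps_represents d s R R' M : keeps d R R' -> represents s R M ->
  represents s R' M.
Proof.
move=> k [hr hv ht]; split=> // [r|v] /=; rewrite k //.
  by move=> d' _; rewrite eq_sym tmp_neq_range.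
by move=> d' _; rewrite eq_sym tmp_neq_var.
Qed.

Definition yields cs d v R M := exists R',
  [/\ safe (R, M) cs, effects (R, M) cs = (R', M), R' (tmp d) = v & keeps d R R'].

Lemma yields_instr i d v R M : straight i -> touched [:: i] (State 0 R M) <= sp ->
  effect w (R, M) i = (upd R (tmp d) v, M) -> yields [:: i] d v R M.
Proof.
move=> st_i acc_i eff_i; exists (upd R (tmp d) v); split=> //=.
- by rewrite st_i acc_i.
- by rewrite /upd eqxx.
- exact: keeps_upd.
Qed.

Lemma yields_pair cs1 cs2 d v1 v2 R M :
  yields cs1 d v1 R M -> (forall R', keeps d R R' -> yields cs2 d.+1 v2 R' M) ->
  exists R', [/\ safe (R, M) (cs1 ++ cs2), effects (R, M) (cs1 ++ cs2) = (R', M),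
                 R' (tmp d) = v1 /\ R' (tmp d.+1) = v2 & keeps d R R'].
Proof.
case=> R1 [safe1 eff1 val1 keep1] /(_ R1 keep1)[R2 [safe2 eff2 val2 keep2]].
exists R2; split.
- by rewrite safe_cat safe1 eff1.
- by rewrite effects_cat eff1.
- by split; rewrite // -val1; apply: keeps_tmp keep2 _.
- exact: keeps_trans keep1 (keeps_weaken (leqnSn d) keep2).
Qed.

Lemma yields_cat cs1 cs2 d v R R' M : safe (R, M) cs1 ->
  effects (R, M) cs1 = (R', M) ->
  keeps d R R' -> yields cs2 d v R' M -> yields (cs1 ++ cs2) d v R M.
Proof.
move=> safe1 eff1 keep1 [R2 [safe2 eff2 val2 keep2]]; exists R2; split=> //.
- by rewrite safe_cat safe1 eff1.
- by rewrite effects_cat eff1.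
- exact: keeps_trans keep1 keep2.
Qed.

Lemma address_code_yields d t R M a b :
  t < T -> R 1 = D -> R (tmp d) = a -> R (tmp d.+1) = b ->
  yields (address_code d t) d (addr t (a %% D) (b %% D)) R M.
Proof.
move=> tT R1 Ra Rb; eexists; split; first by [].
- by rewrite /effects /address_code /= !effectE.
- have xD : a %% D < D by apply: ltn_pmod.
  have yD : b %% D < D by apply: ltn_pmod.
  have addr_w := leq_trans (addr_lt tT xD yD) room.
  have tmp1 e : (1 == tmp e) = false by rewrite eq_sym (tmp_neq_range e Cells).
  have tmp_ne :=
    (ltn_eqF (ltnSn d), gtn_eqF (ltnSn d), ltn_eqF (ltnSn d.+1), ltn_eqF (leqnSn d.+1)).
  rewrite /upd !tmp_eq !tmp1 !eqxx !tmp_ne /eval_binop R1 Ra Rb.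
  have small x : x <= addr t (a %% D) (b %% D) -> x %% 2 ^ w = x.
    by move=> x_le; rewrite modn_small // (leq_ltn_trans x_le).
  by rewrite /addr; do !rewrite small //; rewrite /addr; nia.
- by do !(apply: keeps_trans; last by apply: keeps_upd; lia).
Qed.

Definition expr_simulated e := forall d s R M,
  expr_table_count e <= T -> represents s R M ->
  yields (compile_expr d e) d (eval s e) R M.

Lemma operands_yield e1 e2 d s R M : expr_simulated e1 -> expr_simulated e2 ->
  expr_table_count e1 <= T -> expr_table_count e2 <= T -> represents s R M ->
  exists R', [/\ safe (R, M) (compile_expr d e1 ++ compile_expr d.+1 e2),
    effects (R, M) (compile_expr d e1 ++ compile_expr d.+1 e2) = (R', M),
    R' (tmp d) = eval s e1 /\ R' (tmp d.+1) = eval s e2 & keeps d R R'].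
Proof.
move=> ok1 ok2 T1 T2 rep; apply: yields_pair (ok1 _ _ _ _ T1 rep) _ => R' keep.
exact: ok2 (keeps_represents keep rep).
Qed.

Lemma compile_expr_simulated e : expr_simulated e.
Proof.
elim: e => [c|r|v|o e1 IH1 e2 IH2|t e1 IH1 e2 IH2] d s R M /=.
- by move=> _ _; apply: yields_instr.
- by move=> _ [size_r _ _]; apply: yields_instr; rewrite // effectE size_r.
- by move=> _ [_ var_v _]; apply: yields_instr; rewrite // effectE var_v.
- rewrite geq_max => /andP[T1 T2] rep.
  have [R' [safe' eff' [val1 val2] keep']] := operands_yield d IH1 IH2 T1 T2 rep.
  rewrite catA; apply: (yields_cat safe' eff' keep').
  by apply: yields_instr; rewrite // effectE val1 val2.
- rewrite !geq_max => /and3P[tT T1 T2] rep.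
  have [R1 [safe1 eff1 [val1 val2] keep1]] := operands_yield d IH1 IH2 T1 T2 rep.
  have [size_r _ M_tab] := keeps_represents keep1 rep.
  have [R2 [safe2 eff2 val_addr keep2]] :=
    address_code_yields M tT (size_r Cells) val1 val2.
  rewrite catA; apply: (yields_cat safe1 eff1 keep1).
  apply: (yields_cat safe2 eff2 keep2).
  apply: yields_instr; rewrite ?effectE ?val_addr ?M_tab ?ltn_pmod //.
  by rewrite /touched /fetch /= val_addr (leq_trans _ fits) // addr_lt ?ltn_pmod.
Qed.

Definition simulated c := forall base d s R M, table_count c <= T ->
  code_at p base (compile base d c) -> represents s R M -> exists R' M',
  [/\ runs w p sp (State base R M) (cost n L c)
        (State (base + size (compile base d c)) R' M'),
      represents (exec c s) R' M' & forall d', d' < d -> R' (tmp d') = R (tmp d')].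

Lemma represents_set_var s v x R M :
  represents s R M -> represents (set_var s v x) (upd R (var_reg v) x) M.
Proof.
case=> size_r var_v M_tab; split=> //= [r|v'].
  by rewrite /upd range_neq_var size_r.
by rewrite /upd var_reg_eq; case: eqP => // _; apply: var_v.
Qed.

Lemma Assign_simulated v e : simulated (Assign v e).
Proof.
move=> base d s R M eT code rep.
have [R' [safe' eff' val_e keep']] := compile_expr_simulated d eT rep.
exists (upd R' (var_reg v) (eval s e)), M; split.
- have -> : cost n L (Assign v e) = size (compile base d (Assign v e)).
    by rewrite size_cat size_compile_expr.
  apply: (runs_straight code); first by rewrite safe_cat safe' eff'.
  by rewrite effects_cat eff' /effects /= effectE val_e.
- exact/represents_set_var/(keeps_represents keep').
- by move=> d' d'd; rewrite /upd tmp_neq_var (keeps_tmp keep').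
Qed.

Lemma Put_simulated t e1 e2 e : simulated (Put t e1 e2 e).
Proof.
move=> base d s R M; rewrite [table_count _]/= !geq_max.
case/and4P=> [tT T1 T2 eT] code rep.
have [R1 [safe1 eff1 [val1 val2] keep1]] :=
  operands_yield d (compile_expr_simulated (e := e1))
    (compile_expr_simulated (e := e2)) T1 T2 rep.
have rep1 := keeps_represents keep1 rep; have [size_r _ _] := rep1.
have [R2 [safe2 eff2 val_addr keep2]] :=
  address_code_yields M tT (size_r Cells) val1 val2.
have rep2 := keeps_represents keep2 rep1.
have [R3 [safe3 eff3 val_e keep3]] := compile_expr_simulated d.+1 eT rep2.
have [size_r3 var_v3 M_tab] := keeps_represents keep3 rep2.
set a := addr _ _ _ in val_addr.
have R3a : R3 (tmp d) = a by rewrite (keeps_tmp keep3).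
exists R3, (upd M a (eval s e)); split.
- have -> : cost n L (Put t e1 e2 e) = size (compile base d (Put t e1 e2 e)).
    by rewrite !size_cat !size_compile_expr !addnA.
  apply: (runs_straight code); rewrite -[compile _ _ _]/(_ ++ _ ++ _ ++ _ ++ _) catA.
    rewrite safe_cat safe1 eff1 safe_cat safe2 eff2 safe_cat safe3 eff3 /= andbT.
    by rewrite /touched /fetch /= R3a (leq_trans _ fits) // addr_lt ?ltn_pmod.
  rewrite effects_cat eff1 effects_cat eff2 effects_cat eff3.
  by rewrite /effects /= effectE R3a val_e.
- split=> //= t' x y tT' xD yD; rewrite /upd -M_tab //.
  case: eqP => [/addr_inj|ne].
    by case=> //; rewrite ?ltn_pmod // => -> -> ->; rewrite !eqxx.
  by case: and3P => // -[/eqP et /eqP ex /eqP ey]; case: ne; rewrite et ex ey.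
- move=> d' d'd; rewrite (keeps_tmp keep3) ?(keeps_tmp keep2) ?(keeps_tmp keep1) //.
  exact: ltnW.
Qed.

Lemma range_size_lt r : range_size r < 2 ^ w.
Proof. by case: r => /=; [apply: ltnW | | apply: leq_ltn_trans L_le (ltnW D_lt)]. Qed.

Section Loop.
Variables (base d v : nat) (r : range) (c : cmd).
Let code := compile base d (For v r c).
Let body := compile (base + 4) d.+1 c.
Hypothesis code_base : code_at p base code.

Lemma loop_code :
  [/\ nth Halt p base.+1 = Binop OpLt (tmp d.+1) (tmp d) (range_reg r),
      nth Halt p base.+2 = JumpZ (tmp d.+1) (base + size body + 7),
      nth Halt p base.+3 = Move (var_reg v) (tmp d),
      code_at p (base + 4) body &
      code_at p (base + 4 + size body)
        [:: Const (tmp d.+1) 1; Binop OpAdd (tmp d) (tmp d) (tmp d.+1); Jump base.+1]].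
Proof.
case/code_at_cons: code_base => _.
case/code_at_cons=> i1 /code_at_cons[i2 /code_at_cons[i3]].
by case/code_at_cat; rewrite -[base.+4]addn4.
Qed.

Lemma loop_test R M : let continue := R (tmp d) < R (range_reg r) in
  runs w p sp (State base.+1 R M) 2
    (State (if continue then base.+3 else base + size body + 7)
      (upd R (tmp d.+1) continue) M).
Proof.
have [i1 i2 _ _ _] := loop_code; set continue := R (tmp d) < _ => /=.
apply: (runs_trans (n1 := 1) (n2 := 1)
  (S2 := State base.+2 (upd R (tmp d.+1) continue) M)).
  apply: runs_instr i1 _ _ _; rewrite // effectE /eval_binop modn_small //.
  by rewrite (leq_ltn_trans (leq_b1 _)) // (leq_ltn_trans _ D_lt).
have := runs_JumpZ w sp (upd R (tmp d.+1) continue) M i2.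
by rewrite [upd _ _ _ (tmp _)]/upd eqxx eqb0; case: continue.
Qed.

Lemma loop_step s R M : simulated c -> table_count c <= T -> represents s R M ->
  R (tmp d) < range_size r -> exists R' M',
  [/\ runs w p sp (State base.+1 R M) (cost n L c + 6) (State base.+1 R' M'),
      represents (exec c (set_var s v (R (tmp d)))) R' M',
      R' (tmp d) = (R (tmp d)).+1 & forall d', d' < d -> R' (tmp d') = R (tmp d')].
Proof.
move=> ok_c cT rep lt_r; have [_ _ i3 body_at end_at] := loop_code.
have [size_r _ _] := rep; have := loop_test R M; rewrite size_r lt_r /=.
set k := R (tmp d) in lt_r *; set R1 := upd R (tmp d.+1) 1 => run1.
have R1d : R1 (tmp d) = k by rewrite /R1 /upd tmp_eq ltn_eqF.
have rep1 : represents s R1 M := keeps_represents (keeps_upd R 1 (leqnn d.+1)) rep.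
have [R2 [M2 [run2 rep2 keep2]]] :=
  ok_c _ _ _ _ _ cT body_at (represents_set_var v k rep1).
have R2d : R2 (tmp d) = k by rewrite keep2 // /upd tmp_neq_var.
have k_lt : k.+1 < 2 ^ w by apply: leq_ltn_trans lt_r (range_size_lt r).
pose R3 := upd (upd R2 (tmp d.+1) 1) (tmp d) k.+1.
exists R3, M2; split.
- have -> : cost n L c + 6 = 2 + (1 + (cost n L c + (2 + 1))) by lia.
  apply: (runs_trans run1).
  apply: (runs_trans (S2 := State base.+4 (upd R1 (var_reg v) k) M)).
    by apply: runs_instr i3 _ _ _; rewrite // effectE R1d.
  rewrite -addn4; apply: (runs_trans run2).
  have [incr_at /code_at_cons[jump_at _]] := code_at_cat (cs1 := [:: _; _]) end_at.
  apply: (runs_trans (S2 := State (base + 4 + size body + 2) R3 M2)); last first.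
    exact: runs_Jump.
  apply: (runs_straight incr_at) => //.
  rewrite /effects /= !effectE /R3 /eval_binop /upd !tmp_eq eqxx ltn_eqF // R2d.
  by rewrite !modn_small ?addn1 // (leq_ltn_trans _ k_lt).
- apply: keeps_represents rep2; apply: keeps_trans (keeps_upd _ _ (leqnn d)).
  exact: keeps_upd.
- by rewrite /R3 /upd eqxx.
- move=> d' d'd; rewrite /R3 /upd !tmp_eq !ltn_eqF // 1?ltnW // keep2 1?ltnW //.
  by rewrite /upd tmp_neq_var /R1 /upd tmp_eq ltn_eqF // ltnW.
Qed.

End Loop.

Lemma For_simulated v r c : simulated c -> simulated (For v r c).
Proof.
move=> ok_c base d s R M cT code rep; set body := compile (base + 4) d.+1 c.
pose s_ k := iteri k (fun k s' => exec c (set_var s' v k)) s.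
have loop k : k <= range_size r -> exists R' M',
    [/\ runs w p sp (State base R M) (1 + k * (cost n L c + 6)) (State base.+1 R' M'),
        represents (s_ k) R' M', R' (tmp d) = k &
        forall d', d' < d -> R' (tmp d') = R (tmp d')].
  elim: k => [_|k IH k_lt].
    have /code_at_cons[i0 _] := code; exists (upd R (tmp d) 0), M; split.
    - by apply: runs_instr i0 _ _ _; rewrite // effectE mod0n.
    - exact: keeps_represents (keeps_upd R 0 (leqnn d)) rep.
    - by rewrite /upd eqxx.
    - by move=> d' d'd; rewrite /upd tmp_eq ltn_eqF.
  have [R1 [M1 [run1 rep1 R1d keep1]]] := IH (ltnW k_lt).
  have [|R2 [M2 [run2 rep2 R2d keep2]]] := loop_step code ok_c cT rep1.
    by rewrite R1d.
  exists R2, M2; split; rewrite ?R2d ?R1d //.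
  - by rewrite mulSn addnCA addnC; apply: runs_trans run1 run2.
  - by move: rep2; rewrite R1d.
  - by move=> d' d'd; rewrite keep2 ?keep1.
have [R1 [M1 [run1 rep1 R1d keep1]]] := loop _ (leqnn _).
have := loop_test code R1 M1; have [size_r _ _] := rep1.
rewrite R1d size_r ltnn => run2; exists (upd R1 (tmp d.+1) false), M1; split.
- have -> : cost n L (For v r c) = 1 + range_size r * (cost n L c + 6) + 2.
    by rewrite /=; lia.
  apply: (runs_trans run1); rewrite (_ : base + size _ = base + size body + 7) //.
  by rewrite /= size_cat /= -/body; lia.
- exact: keeps_represents (keeps_upd R1 false (leqnn d.+1)) rep1.
- by move=> d' d'd; rewrite /upd tmp_eq ltn_eqF ?keep1 // ltnW.
Qed.

Lemma compile_simulated c : simulated c.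
Proof.
elim: c => [v e|t e1 e2 e||c1 IH1 c2 IH2|v r c IH].
- exact: Assign_simulated.
- exact: Put_simulated.
- move=> base d s R M _ _ rep; exists R, M; split=> //.
  by rewrite addn0; apply: runs0.
- move=> base d s R M; rewrite [table_count _]/= geq_max.
  case/andP=> [T1 T2] /code_at_cat[at1 at2] rep.
  have [R1 [M1 [run1 rep1 keep1]]] := IH1 _ _ _ _ _ T1 at1 rep.
  have [R2 [M2 [run2 rep2 keep2]]] := IH2 _ _ _ _ _ T2 at2 rep1.
  exists R2, M2; split=> //; last by move=> d' d'd; rewrite keep2 ?keep1.
  by rewrite /= size_cat addnA; apply: runs_trans run1 run2.
- exact: For_simulated.
Qed.

End Compilation.

(** * Loops *)

Fixpoint assigns (c : cmd) (v : nat) : bool :=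
  match c with
  | Assign v' _ => v' == v
  | Put _ _ _ _ | Skip => false
  | Seq c1 c2 => assigns c1 v || assigns c2 v
  | For v' _ c => (v' == v) || assigns c v
  end.

Fixpoint puts (c : cmd) (t : nat) : bool :=
  match c with
  | Put t' _ _ _ => t' == t
  | Seq c1 c2 => puts c1 t || puts c2 t
  | For _ _ c => puts c t
  | _ => false
  end.

Definition frame c s s' :=
  (forall v, ~~ assigns c v -> var s' v = var s v) /\
  (forall t, ~~ puts c t -> tab s' t = tab s t).

Definition cseq : seq cmd -> cmd := foldr Seq Skip.
Arguments cseq : simpl never.

Lemma assigns_cseq l v : assigns (cseq l) v = has (assigns ^~ v) l.
Proof. by elim: l => //= c l <-. Qed.

Lemma puts_cseq l t : puts (cseq l) t = has (puts ^~ t) l.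
Proof. by elim: l => //= c l <-. Qed.

Lemma frame_refl c s : frame c s s. Proof. by []. Qed.

Lemma frame_trans c s1 s2 s3 : frame c s1 s2 -> frame c s2 s3 -> frame c s1 s3.
Proof.
by move=> [v1 t1] [v2 t2]; split=> [v|t] h; [rewrite v2 ?v1 | rewrite t2 ?t1].
Qed.

Lemma frame_weaken c c' s s' :
  (forall v, assigns c v -> assigns c' v) -> (forall t, puts c t -> puts c' t) ->
  frame c s s' -> frame c' s s'.
Proof.
move=> sub_v sub_t [fv ft]; split=> [v|t] h.
  by apply: fv; apply: contra h; apply: sub_v.
by apply: ft; apply: contra h; apply: sub_t.
Qed.

Lemma frame_set_var v r c s k : frame (For v r c) s (set_var s v k).
Proof.
by split=> //= v'; rewrite negb_or => /andP[ne _]; rewrite /upd eq_sym (negPf ne).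
Qed.

Section Loops.
Variables (w n L : nat).
Local Notation exec := (exec w n L).
Local Notation range_size := (range_size n L).

Lemma exec_cons c l s : exec (cseq (c :: l)) s = exec (cseq l) (exec c s).
Proof. by []. Qed.

Lemma exec_nil s : exec (cseq [::]) s = s. Proof. by []. Qed.

Lemma exec_cat l1 l2 s : exec (cseq (l1 ++ l2)) s = exec (cseq l2) (exec (cseq l1) s).
Proof. by elim: l1 s => //= c l1 IH s; rewrite !exec_cons IH. Qed.

Lemma exec_frame c s : frame c s (exec c s).
Proof.
elim: c s => [v e|t e1 e2 e||c1 IH1 c2 IH2|v r c IH] s.
- by split=> //= v' ne; rewrite /upd eq_sym (negPf ne).
- by split=> //= t' ne; rewrite [t' == t]eq_sym (negPf ne).
- exact: frame_refl.
- rewrite execE; apply: (@frame_trans _ _ (exec c1 s)).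
    by apply: frame_weaken (IH1 s) => x /= ->.
  by apply: frame_weaken (IH2 _) => x /= ->; rewrite orbT.
rewrite /exec /= -/exec; elim: (range_size r) => [|k IHk]; first exact: frame_refl.
apply: frame_trans IHk _; apply: frame_trans (frame_set_var v r c _ k) _.
by apply: frame_weaken (IH _) => //= v' ->; rewrite orbT.
Qed.

Lemma exec_var c s v : ~~ assigns c v -> var (exec c s) v = var s v.
Proof. by case: (exec_frame c s) => fv _; apply: fv. Qed.

Lemma exec_tab c s t : ~~ puts c t -> tab (exec c s) t = tab s t.
Proof. by case: (exec_frame c s) => _ ft; apply: ft. Qed.

Lemma exec_for_ind (P : nat -> store -> Prop) v r c s :
  P 0 s ->
  (forall k s', k < range_size r -> frame (For v r c) s s' -> P k s' ->
     P k.+1 (exec c (set_var s' v k))) ->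
  P (range_size r) (exec (For v r c) s).
Proof.
move=> P0 Pstep; set f := fun k s' => exec c (set_var s' v k).
suff inv k : k <= range_size r ->
    frame (For v r c) s (iteri k f s) /\ P k (iteri k f s).
  by case: (inv _ (leqnn _)).
elim: k => [|k IH] k_le; first by split=> //; apply: frame_refl.
have [fr Pk] := IH (ltnW k_le); split; last exact: Pstep.
apply: frame_trans fr _; apply: frame_trans (frame_set_var v r c _ k) _.
by apply: frame_weaken (exec_frame c _) => //= v' ->; rewrite orbT.
Qed.

End Loops.

Definition point1 := 0.
Definition point2 := 1.
Definition bit1 := 2.
Definition bit2 := 3.
Definition bit3 := 4.
Definition bit4 := 5.
Definition running_sum := 6.

Definition for_pairs r c := For point1 r (For point2 r c).

Lemma exec_for_pairs_ind w n L (P : nat -> nat -> store -> Prop) r c s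
    (m := range_size n L r) :
  ~~ assigns c point1 ->
  P 0 0 s ->
  (forall k l s' v x,
     v \in [:: point1; point2] -> P k l s' -> P k l (set_var s' v x)) ->
  (forall k l s', k < m -> l < m -> var s' point1 = k -> var s' point2 = l ->
     frame (for_pairs r c) s s' -> P k l s' -> P k l.+1 (exec w n L c s')) ->
  (forall k s', k < m -> P k m s' -> P k.+1 0 s') ->
  P m 0 (exec w n L (for_pairs r c) s).
Proof.
move=> c1 P0 Pset Pstep Pnext.
apply: (exec_for_ind (P := fun k s' => P k 0 s')) => // k s1 k_lt fr1 Pk.
apply: Pnext => //.
apply: (exec_for_ind (P := fun l s' => P k l s')) => [|l s2 l_lt fr2 Pl].
  exact: Pset.
apply: Pstep => //=.
- by rewrite /upd /=; case: fr2 => -> //=; rewrite negb_or.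
- apply: frame_trans fr1 _; apply: frame_trans (frame_set_var _ _ _ _ k) _.
  apply: (frame_trans (s2 := s2)).
    by apply: frame_weaken fr2 => //= v ->; rewrite orbT.
  by apply: frame_weaken (frame_set_var point2 r c s2 l) => //= v ->; rewrite orbT.
- by apply: Pset; rewrite // !inE eqxx orbT.
Qed.

Lemma exec_for_pairs_map w n L r t e (Q : nat -> nat -> nat -> Prop) s
    (m := range_size n L r) :
  m <= n.+1 ->
  let c := for_pairs r (Put t (Var point1) (Var point2) e) in
  (forall x z s', x < m -> z < m -> var s' point1 = x -> var s' point2 = z ->
     frame c s s' -> tab s' t x z = tab s t x z -> Q x z (eval w n L s' e)) ->
  forall x z, x < m -> z < m -> Q x z (tab (exec w n L c s) t x z).
Proof.
move=> m_le c Qe; pose done k l x z := (x < k) || (x == k) && (z < l).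
pose P k l s' := forall x z, x < m -> z < m ->
  if done k l x z then Q x z (tab s' t x z) else tab s' t x z = tab s t x z.
have : P m 0 (exec w n L c s).
  apply: exec_for_pairs_ind => //
    [x z|k l s' k_lt l_lt s'1 s'2 fr Pkl x z x_lt z_lt|k s' k_lt Pk x z x_lt z_lt].
  - by rewrite /done !ltn0 andbF.
  - rewrite execE !evalE s'1 s'2 /= !modn_small ?(leq_trans _ m_le) // eqxx /=.
    case: andP => [[/eqP-> /eqP->]|ne].
      rewrite /done ltnn eqxx leqnn /=; apply: Qe => //.
      by have := Pkl k l k_lt l_lt; rewrite /done !ltnn andbF.
    have -> : done k l.+1 x z = done k l x z by rewrite /done; move: ne; lia.
    exact: Pkl.
  - have -> : done k.+1 0 x z = done k m x z by rewrite /done; move: z_lt; lia.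
    exact: Pk.
by move=> Pm x z x_lt z_lt; have := Pm x z x_lt z_lt; rewrite /done x_lt.
Qed.

(** * Table-filling passes *)

Definition input := 0.
Definition classes1 := 1.
Definition classes2 := 2.
Definition buckets := 3.
Definition gathered := 4.

Definition height (e : expr) := Op OpSub (Get input (Lit 0) e) (Lit 1).
Definition shifted e i := Op OpShr e (Var i).
Definition digit_expr e i := Op OpMod (shifted e i) (Lit 2).
Definition twin_expr e i := Op OpMul (Op OpDiv (shifted e i) (Lit 2)) (Lit 2).
Definition class_expr t e i j := Get t (shifted e i) (shifted (height e) j).
Definition threshold_expr x z t :=
  match t with
  | AtZero => Lit 0 | AtEnd => Size Points
  | AtP => x | AfterP => Op OpAdd x (Lit 1)
  | AtQ => z | AfterQ => Op OpAdd z (Lit 1)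
  end.

Definition corner_x (s : bool * (threshold * threshold)) :=
  threshold_expr (Var point1) (Var point2) s.2.1.
Definition corner_y (s : bool * (threshold * threshold)) :=
  threshold_expr (height (Var point1)) (height (Var point2)) s.2.2.
Definition corner_digits s i j :=
  Op OpMul (digit_expr (corner_x s) i) (digit_expr (corner_y s) j).
Definition corner_class t s i j :=
  Get t (twin_expr (corner_x s) i) (twin_expr (corner_y s) j).
Definition corner_level (k : corner) :=
  Op OpMul (Op OpMul (corner_digits k.1 bit1 bit2) (corner_digits k.2 bit3 bit4))
    (Get buckets (corner_class classes1 k.1 bit1 bit2)
                 (corner_class classes2 k.2 bit3 bit4)).

Definition clear t := for_pairs Cells (Put t (Var point1) (Var point2) (Lit 0)).

Definition number_classes t i j :=
  Seq (clear t)
    (For point1 Points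
       (Put t (shifted (Var point1) i) (shifted (height (Var point1)) j)
          (Op OpAdd (Var point1) (Lit 1)))).

Definition fill_buckets src :=
  let N := class_expr classes1 (Var point1) bit1 bit2 in
  let M := class_expr classes2 (Var point2) bit3 bit4 in
  Seq (clear buckets)
    (for_pairs Points
       (Put buckets N M
          (Op OpAdd (Get buckets N M) (Get src (Var point1) (Var point2))))).

Definition modify t o e :=
  for_pairs Points
    (Put t (Var point1) (Var point2) (Op o (Get t (Var point1) (Var point2)) e)).

Definition prepare_level src :=
  Seq (number_classes classes1 bit1 bit2)
    (Seq (number_classes classes2 bit3 bit4) (fill_buckets src)).

Definition gather_level src k :=
  Seq (prepare_level src)
    (modify gathered (if corner_sign k then OpSub else OpAdd) (corner_level k)).

Definition gather_corner src k :=
  For bit1 Bits (For bit2 Bits (For bit3 Bits (For bit4 Bits (gather_level src k)))).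

Section Passes.
Variables (w n L : nat) (y : nat -> nat).
Local Notation exec := (exec w n L).
Local Notation eval := (eval w n L).
Hypothesis wide : n.+2 < 2 ^ w.
Hypothesis y_lt : forall r, r < n -> y r < n.
Implicit Types (s : store) (t : nat) (e x z : expr).

Definition reads_input s := forall r, r < n -> tab s input 0 r = (y r).+1.

Lemma frame_reads_input c s s' :
  frame c s s' -> ~~ puts c input -> reads_input s -> reads_input s'.
Proof. by move=> [_ ft] c_in in_s r rn; rewrite ft // in_s. Qed.

Lemma modn_word_small a : a <= n.+2 -> a %% 2 ^ w = a.
Proof. by move=> a_le; rewrite modn_small // (leq_ltn_trans a_le). Qed.

Lemma modn_word_le a : a <= n -> a %% 2 ^ w = a.
Proof.
by move=> an; apply: modn_word_small; apply: leq_trans an (leqW (leqnSn n)).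
Qed.

Lemma modn_index a : a <= n -> a %% n.+1 = a.
Proof. by move=> an; rewrite modn_small. Qed.

Lemma eval_Lit s a : a <= n.+2 -> eval s (Lit a) = a.
Proof. exact: modn_word_small. Qed.

Lemma eval_height s e p : reads_input s -> eval s e = p -> p < n ->
  eval s (height e) = y p.
Proof.
move=> in_s ep pn; rewrite !evalE ep mod0n (modn_index (ltnW pn)).
rewrite [0 %% _]modn_small // in_s // (modn_word_small (a := 1)) // /eval_binop.
rewrite (_ : _ + _ = y p + 2 ^ w); last by move: wide; lia.
by rewrite modnDr modn_word_le // ltnW // y_lt.
Qed.

Lemma eval_succ s e a : eval s e = a -> a < n -> eval s (Op OpAdd e (Lit 1)) = a.+1.
Proof.
by move=> ea an; rewrite evalE ea eval_Lit // /eval_binop addn1 modn_word_le.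
Qed.

Lemma eval_shifted s e i a : eval s e = a -> a <= n ->
  eval s (shifted e i) = a %/ 2 ^ var s i.
Proof.
move=> ea an; rewrite !evalE ea; apply: modn_word_le.
exact: leq_trans (leq_div _ _) an.
Qed.

Lemma eval_digit_expr s e i a : eval s e = a -> a <= n ->
  eval s (digit_expr e i) = digit (var s i) a.
Proof.
move=> ea an; rewrite evalE (eval_shifted i ea an) eval_Lit //.
by apply: modn_word_small; apply: leq_trans (ltnW (ltn_pmod _ _)) _.
Qed.

Lemma eval_twin_expr s e i a : eval s e = a -> a <= n ->
  eval s (twin_expr e i) = twin (var s i) a.
Proof.
move=> ea an; rewrite /twin_expr 2!evalE (eval_shifted i ea an) eval_Lit //.
rewrite /eval_binop [X in X * 2]modn_word_le.
  by apply: modn_word_le; apply: leq_trans (twin_le _ _) an.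
by do 2!apply: leq_trans (leq_div _ _) _.
Qed.

Lemma eval_class_expr s t e i j r : reads_input s -> eval s e = r -> r < n ->
  let cl := class_of y (var s i) (var s j) r in
  eval s (class_expr t e i j) = tab s t cl.1 cl.2.
Proof.
move=> in_s er rn; rewrite evalE (eval_shifted i er (ltnW rn)).
rewrite (eval_shifted j (eval_height in_s er rn) (ltnW (y_lt rn))).
have /andP[x_le y_le] := class_of_le y_lt (var s i) (var s j) rn.
by rewrite !modn_index.
Qed.

Lemma eval_threshold_expr s x z (thr : threshold) p q :
  eval s x = p -> eval s z = q -> p < n -> q < n ->
  eval s (threshold_expr x z thr) = threshold_value n p q thr.
Proof.
move=> xp zq pn qn; case: thr => //=.
- exact: eval_Lit.
- exact: eval_succ.
- exact: eval_succ.
Qed.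

Lemma exec_clear t s a b : a <= n -> b <= n -> tab (exec (clear t) s) t a b = 0.
Proof.
move=> an bn.
apply: (@exec_for_pairs_map _ _ _ Cells _ _ (fun _ _ v => v = 0)) => // *.
by rewrite evalE mod0n.
Qed.

Lemma exec_number_classes t i j s : t != input -> point2 < i -> point2 < j ->
  reads_input s ->
  numbering n y (var s i) (var s j) (tab (exec (number_classes t i j) s) t) n.
Proof.
move=> t_in i_gt j_gt in_s; rewrite execE; set s0 := exec (clear t) s.
have fr0 : frame (clear t) s s0 := exec_frame w n L (clear t) s.
have in_s0 : reads_input s0 by apply: (frame_reads_input fr0).
have keep v : point2 < v -> var s0 v = var s v.
  by case: fr0 => fv _ v_gt; rewrite fv //= !ltn_eqF // (leq_trans _ v_gt).
rewrite -!keep //.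
pose P k s' := numbering n y (var s0 i) (var s0 j) (tab s' t) k.
apply: (exec_for_ind (P := P)) => [X Y Xn Yn|k s' kn fr num].
  by rewrite /s0 exec_clear.
have in_s' : reads_input (set_var s' point1 k) by apply: (frame_reads_input fr).
have var_v v : point2 < v -> var (set_var s' point1 k) v = var s0 v.
  case: fr => fv _ v_gt; have v1 : point1 < v by apply: ltn_trans v_gt.
  by rewrite /= /upd gtn_eqF // fv //= ltn_eqF.
have e1 : eval (set_var s' point1 k) (Var point1) = k by rewrite evalE /= /upd eqxx.
have /andP[x_le y_le] := class_of_le y_lt (var s0 i) (var s0 j) kn.
rewrite execE (eval_shifted i e1 (ltnW kn)) (eval_succ e1 kn).
rewrite (eval_shifted j (eval_height in_s' e1 kn) (ltnW (y_lt kn))) !var_v //.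
rewrite !modn_index // => X Y Xn Yn /=; rewrite eqxx /=.
have -> : (X == k %/ 2 ^ var s0 i) && (Y == y k %/ 2 ^ var s0 j) =
    (class_of y (var s0 i) (var s0 j) k == (X, Y)).
  by rewrite xpair_eqE ![_ == X]eq_sym ![_ == Y]eq_sym.
case: ifP => [->|k_cl]; first by rewrite ltnSn.
have := num X Y Xn Yn.
case: (tab s' t X Y) => [none r|r /andP[rk ->]]; last by rewrite ltnS ltnW.
by rewrite ltnS leq_eqVlt => /orP[/eqP->|/none //]; rewrite k_cl.
Qed.

Lemma exec_modify t o e (Q : nat -> nat -> nat -> Prop) s :
  (forall p q s', p < n -> q < n -> var s' point1 = p -> var s' point2 = q ->
     frame (modify t o e) s s' -> Q p q (eval_binop w o (tab s t p q) (eval s' e))) ->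
  forall p q, p < n -> q < n -> Q p q (tab (exec (modify t o e) s) t p q).
Proof.
move=> Qe; apply: (@exec_for_pairs_map _ _ _ Points _ _ Q) => //=.
move=> p q s' pn qn s'1 s'2 fr tab_pq.
by rewrite !evalE s'1 s'2 !modn_index ?tab_pq ?(ltnW pn) ?(ltnW qn) //; apply: Qe.
Qed.

Section RingPasses.
Local Open Scope ring_scope.
Variable R : comNzRingType.
Hypothesis word_zero : (2 ^ w)%N%:R = 0 :> R.
Implicit Type B : nat -> nat -> R.

Lemma natr_word (a : nat) : (a %% 2 ^ w)%N%:R = a%:R :> R.
Proof. by rewrite {2}(divn_eq a (2 ^ w)) natrD natrM word_zero mulr0 add0r. Qed.

Lemma natr_OpAdd a b : (eval_binop w OpAdd a b)%:R = a%:R + b%:R :> R.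
Proof. by rewrite natr_word natrD. Qed.

Lemma natr_OpMul a b : (eval_binop w OpMul a b)%:R = a%:R * b%:R :> R.
Proof. by rewrite natr_word natrM. Qed.

Lemma natr_OpSub a b : (b <= 2 ^ w)%N ->
  (eval_binop w OpSub a b)%:R = a%:R - b%:R :> R.
Proof. by move=> b_le; rewrite natr_word natrD natrB // word_zero sub0r. Qed.

Definition holds t B s := forall p q, (p < n)%N -> (q < n)%N ->
  (tab s t p q)%:R = B p q.

Lemma frame_holds c t B s s' :
  frame c s s' -> ~~ puts c t -> holds t B s -> holds t B s'.
Proof. by move=> [_ ft] c_t hB p q pn qn; rewrite ft // hB. Qed.

Lemma exec_fill_buckets src B s : buckets != src -> reads_input s -> holds src B s ->
  numbering n y (var s bit1) (var s bit2) (tab s classes1) n ->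
  numbering n y (var s bit3) (var s bit4) (tab s classes2) n ->
  forall N M, (N <= n)%N -> (M <= n)%N ->
    (tab (exec (fill_buckets src) s) buckets N M)%:R =
    bucket n y (var s bit1) (var s bit2) (var s bit3) (var s bit4)
      (tab s classes1) (tab s classes2) B N M.
Proof.
move=> src_b in_s hB num1 num2.
pose cl1 := class_of y (var s bit1) (var s bit2).
pose cl2 := class_of y (var s bit3) (var s bit4).
pose hit r q N M : R :=
  ((tab s classes1 (cl1 r).1 (cl1 r).2 == N) &&
    (tab s classes2 (cl2 q).1 (cl2 q).2 == M))%:R * B r q.
pose P k l s' := forall N M, (N <= n)%N -> (M <= n)%N -> (tab s' buckets N M)%:R =
  \sum_(r < k) \sum_(q < n) hit r q N M + \sum_(q < l) hit k q N M.
rewrite execE; set s0 := exec (clear buckets) s; set c := for_pairs _ _.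
have fr0 : frame (clear buckets) s s0 := exec_frame w n L (clear buckets) s.
have : P n 0%N (exec c s0).
  apply: (exec_for_pairs_ind (P := P) (r := Points)) => //
    [N M Nn Mn|k l s' kn ln s'1 s'2 fr Pkl|k s' kn Pk N M Nn Mn].
  - by rewrite /s0 exec_clear // !big_ord0 addr0.
  - have {}fr : frame (Seq (clear buckets) c) s s'.
      apply: (@frame_trans _ _ s0); first by apply: frame_weaken fr0 => x /= ->.
      by apply: frame_weaken fr => x /= ->; rewrite orbT.
    have in_s' := frame_reads_input fr isT in_s; have [fv ft] := fr.
    rewrite execE; set N0 := class_expr _ _ _ _; set M0 := class_expr _ _ _ _.
    have e1 : eval s' N0 = tab s classes1 (cl1 k).1 (cl1 k).2.
      by rewrite (eval_class_expr (e := Var point1) _ _ _ in_s' s'1 kn) !fv ?ft.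
    have e2 : eval s' M0 = tab s classes2 (cl2 l).1 (cl2 l).2.
      by rewrite (eval_class_expr (e := Var point2) _ _ _ in_s' s'2 ln) !fv ?ft.
    have /andP[x1 y1] := class_of_le y_lt (var s bit1) (var s bit2) kn.
    have /andP[x2 y2] := class_of_le y_lt (var s bit3) (var s bit4) ln.
    have e1n : (eval s' N0 <= n)%N by rewrite e1 (numbering_le num1).
    have e2n : (eval s' M0 <= n)%N by rewrite e2 (numbering_le num2).
    move=> N M Nn Mn; rewrite !modn_index //= big_ord_recr addrA -(Pkl N M Nn Mn).
    rewrite /hit -e1 -e2 /= [N == _]eq_sym [M == _]eq_sym.
    case: andP => [[/eqP eN /eqP eM]|_]; last by rewrite mul0r addr0.
    rewrite evalE natr_OpAdd mul1r [eval _ (Get buckets _ _)]evalE.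
    rewrite !modn_index // eN eM !evalE s'1 s'2.
    by rewrite !modn_index ?(ltnW kn) ?(ltnW ln) // (ft src) ?hB // /c /= orbb.
  - by rewrite big_ord0 addr0 big_ord_recr Pk.
by move=> Pn N M Nn Mn; rewrite Pn // big_ord0 addr0.
Qed.

Section CornerLevel.
Variables (k : corner) (B : nat -> nat -> R) (s : store) (p q : nat).
Hypotheses (pn : (p < n)%N) (qn : (q < n)%N) (in_s : reads_input s).
Hypotheses (s1 : var s point1 = p) (s2 : var s point2 = q).
Hypothesis num1 : numbering n y (var s bit1) (var s bit2) (tab s classes1) n.
Hypothesis num2 : numbering n y (var s bit3) (var s bit4) (tab s classes2) n.
Hypothesis filled : forall N M, (N <= n)%N -> (M <= n)%N -> (tab s buckets N M)%:R =
  bucket n y (var s bit1) (var s bit2) (var s bit3) (var s bit4)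
    (tab s classes1) (tab s classes2) B N M.

Lemma eval_corner_x sg : eval s (corner_x sg) = threshold_value n p q sg.2.1.
Proof. exact: eval_threshold_expr. Qed.

Lemma eval_corner_y sg : eval s (corner_y sg) = threshold_value n (y p) (y q) sg.2.2.
Proof. by apply: eval_threshold_expr; rewrite ?y_lt //; apply: eval_height. Qed.

Lemma eval_corner_digits sg i j : (eval s (corner_digits sg i j))%:R =
  (digit (var s i) (threshold_value n p q sg.2.1))%:R *
  (digit (var s j) (threshold_value n (y p) (y q) sg.2.2))%:R :> R.
Proof.
rewrite evalE natr_OpMul.
rewrite (eval_digit_expr _ (eval_corner_x sg)) ?threshold_value_le //.
by rewrite (eval_digit_expr _ (eval_corner_y sg)) ?threshold_value_le ?y_lt.
Qed.

Lemma eval_corner_class t sg i j : eval s (corner_class t sg i j) =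
  tab s t (twin (var s i) (threshold_value n p q sg.2.1))
          (twin (var s j) (threshold_value n (y p) (y q) sg.2.2)).
Proof.
have twin_n i0 a : (a <= n -> twin i0 a <= n)%N by apply: leq_trans; apply: twin_le.
rewrite evalE (eval_twin_expr _ (eval_corner_x sg)) ?threshold_value_le //.
rewrite (eval_twin_expr _ (eval_corner_y sg)) ?threshold_value_le ?y_lt //.
by rewrite !modn_index ?twin_n ?threshold_value_le ?y_lt.
Qed.

Lemma eval_corner_level : (eval s (corner_level k))%:R =
  level n y (var s bit1) (var s bit2) (var s bit3) (var s bit4)
    (threshold_value n p q k.1.2.1) (threshold_value n (y p) (y q) k.1.2.2)
    (threshold_value n p q k.2.2.1) (threshold_value n (y p) (y q) k.2.2.2) B.
Proof.
have twin_n i0 a : (a <= n -> twin i0 a <= n)%N by apply: leq_trans; apply: twin_le.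
rewrite (level_bucket y_lt _ num1 num2) ?threshold_value_le ?y_lt //.
rewrite -filled; last 2 first.
- by apply: numbering_le num1 _ _; rewrite twin_n ?threshold_value_le ?y_lt.
- by apply: numbering_le num2 _ _; rewrite twin_n ?threshold_value_le ?y_lt.
rewrite evalE natr_OpMul evalE natr_OpMul !eval_corner_digits -!natrM.
rewrite evalE !eval_corner_class.
rewrite !modn_index // ?(numbering_le num1) ?(numbering_le num2) ?twin_n //;
  by rewrite threshold_value_le ?y_lt.
Qed.

End CornerLevel.

Lemma exec_prepare_level src B s (s' := exec (prepare_level src) s) :
  (buckets < src)%N -> reads_input s -> holds src B s ->
  [/\ numbering n y (var s bit1) (var s bit2) (tab s' classes1) n,
      numbering n y (var s bit3) (var s bit4) (tab s' classes2) n &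
      forall N M, (N <= n)%N -> (M <= n)%N -> (tab s' buckets N M)%:R =
        bucket n y (var s bit1) (var s bit2) (var s bit3) (var s bit4)
          (tab s' classes1) (tab s' classes2) B N M].
Proof.
move=> src_gt in_s hB; have not_src t : (t <= buckets)%N -> t != src.
  by move=> t_le; rewrite ltn_eqF // (leq_ltn_trans t_le).
pose c1 := number_classes classes1 bit1 bit2.
pose c2 := number_classes classes2 bit3 bit4.
rewrite {}/s' -[exec _ _]/(exec (fill_buckets src) (exec c2 (exec c1 s))).
have num1 := @exec_number_classes classes1 bit1 bit2 s isT isT isT in_s.
have in_s1 := frame_reads_input (exec_frame w n L c1 s) isT in_s.
have hB1 : holds src B (exec c1 s).
  by apply: frame_holds (exec_frame _ _ _ _ _) _ hB; rewrite /= orbb not_src.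
rewrite -/c1 in num1; set s1 := exec c1 s in num1 in_s1 hB1 *.
have v1 v : (bit1 <= v)%N -> var s1 v = var s v.
  by move=> v_ge; apply: exec_var; rewrite /= !ltn_eqF // (leq_trans _ v_ge).
have num2 := @exec_number_classes classes2 bit3 bit4 s1 isT isT isT in_s1.
have in_s2 := frame_reads_input (exec_frame w n L c2 s1) isT in_s1.
have hB2 : holds src B (exec c2 s1).
  by apply: frame_holds (exec_frame _ _ _ _ _) _ hB1; rewrite /= orbb not_src.
rewrite -/c2 in num2; set s2 := exec c2 s1 in num2 in_s2 hB2 *.
have v2 v : (bit1 <= v)%N -> var s2 v = var s v.
  move=> v_ge; rewrite -v1 //; apply: exec_var.
  by rewrite /= !ltn_eqF // (leq_trans _ v_ge).
have t2 : tab s2 classes1 = tab s1 classes1 by apply: exec_tab.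
have fill_tab t : ~~ puts (fill_buckets src) t ->
    tab (exec (fill_buckets src) s2) t = tab s2 t.
  exact: exec_tab.
rewrite !v1 // in num2; rewrite (fill_tab classes1) // (fill_tab classes2) // t2.
split=> // N M Nn Mn.
have := exec_fill_buckets (not_src _ (leqnn _)) in_s2 hB2; rewrite !v2 // t2.
by move=> /(_ num1 num2 N M Nn Mn).
Qed.

Definition level_term (k : corner) B i j i' j' p q : R :=
  (-1) ^+ corner_sign k * level n y i j i' j'
    (threshold_value n p q k.1.2.1) (threshold_value n (y p) (y q) k.1.2.2)
    (threshold_value n p q k.2.2.1) (threshold_value n (y p) (y q) k.2.2.2) B.

Lemma exec_gather_level src k B s : (gathered < src)%N -> reads_input s ->
  holds src B s ->
  forall p q, (p < n)%N -> (q < n)%N ->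
  (tab (exec (gather_level src k) s) gathered p q)%:R =
    (tab s gathered p q)%:R +
    level_term k B (var s bit1) (var s bit2) (var s bit3) (var s bit4) p q.
Proof.
move=> src_gt in_s hB; rewrite execE; set s1 := exec (prepare_level src) s.
have [num1 num2 filled] := exec_prepare_level (ltnW src_gt) in_s hB;
  rewrite -/s1 in num1 num2 filled.
have fr1 : frame (prepare_level src) s s1 := exec_frame _ _ _ _ _.
have in_s1 := frame_reads_input fr1 isT in_s.
have v1 v : (bit1 <= v)%N -> var s1 v = var s v.
  by case: fr1 => fv _ v_ge; rewrite fv //= !ltn_eqF // (leq_trans _ v_ge).
have <- : tab s1 gathered = tab s gathered by case: fr1 => _; apply.
apply: (exec_modify (Q := fun p q v => v%:R = (tab s1 gathered p q)%:R +
  level_term k B (var s bit1) (var s bit2) (var s bit3) (var s bit4) p q)).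
move=> p q s2 pn qn s2p s2q fr2.
have in_s2 := frame_reads_input fr2 isT in_s1.
have [fv2 ft2] := fr2.
have v2 v : (bit1 <= v)%N -> var s2 v = var s v.
  by move=> v_ge; rewrite fv2 ?v1 //= !ltn_eqF // (leq_trans _ v_ge).
have := eval_corner_level k (B := B) pn qn in_s2 s2p s2q; rewrite !v2 // !ft2 //.
move=> /(_ num1 num2 filled) eval_k; rewrite /level_term -eval_k.
case: (corner_sign k).
  by rewrite natr_OpSub ?expr1 ?mulN1r // ltnW // ltn_pmod // expn_gt0.
by rewrite natr_OpAdd expr0 mul1r.
Qed.

Lemma exec_for_sum v r t c s (G : nat -> nat -> nat -> R) :
  (forall k s', (k < range_size n L r)%N -> frame (For v r c) s s' ->
     forall p q, (p < n)%N -> (q < n)%N ->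
       (tab (exec c (set_var s' v k)) t p q)%:R = (tab s' t p q)%:R + G k p q) ->
  forall p q, (p < n)%N -> (q < n)%N -> (tab (exec (For v r c) s) t p q)%:R =
    (tab s t p q)%:R + \sum_(k < range_size n L r) G k p q.
Proof.
move=> step; pose P k s' := forall p q, (p < n)%N -> (q < n)%N ->
  (tab s' t p q)%:R = (tab s t p q)%:R + \sum_(i < k) G i p q.
apply: (exec_for_ind (P := P)) => [p q _ _|k s' k_lt fr Pk p q pn qn].
  by rewrite big_ord0 addr0.
by rewrite step // Pk // big_ord_recr addrA.
Qed.

Lemma exec_gather_corner_levels src k B s :
  (gathered < src)%N -> reads_input s -> holds src B s ->
  forall p q, (p < n)%N -> (q < n)%N ->
  (tab (exec (gather_corner src k) s) gathered p q)%:R =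
    (tab s gathered p q)%:R + \sum_(i < L) \sum_(j < L) \sum_(i' < L) \sum_(j' < L)
                                level_term k B i j i' j' p q.
Proof.
move=> src_gt in_s hB; pose ready s0 := reads_input s0 /\ holds src B s0.
have keep_ready c s0 s' : frame c s0 s' -> ~~ puts c input -> ~~ puts c src ->
    ready s0 -> ready s'.
  move=> fr c_in c_src [in0 hB0]; split; first exact: frame_reads_input fr c_in in0.
  exact: frame_holds fr c_src hB0.
have not_src : ~~ puts (gather_level src k) src.
  by rewrite /= !ltn_eqF // (ltn_trans _ src_gt).
apply: (exec_for_sum (r := Bits) (G := fun i p q => \sum_(j < L) \sum_(i' < L)
  \sum_(j' < L) level_term k B i j i' j' p q)) => i s1 _ fr1.
have ready1 : ready s1 := keep_ready _ _ _ fr1 isT not_src (conj in_s hB).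
apply: (exec_for_sum (r := Bits) (s := set_var s1 bit1 i) (G := fun j p q =>
  \sum_(i' < L) \sum_(j' < L) level_term k B i j i' j' p q)) => j s2 _ fr2.
have ready2 : ready s2 := keep_ready _ _ _ fr2 isT not_src ready1.
apply: (exec_for_sum (r := Bits) (s := set_var s2 bit2 j) (G := fun i' p q =>
  \sum_(j' < L) level_term k B i j i' j' p q)) => i' s3 _ fr3.
have ready3 : ready s3 := keep_ready _ _ _ fr3 isT not_src ready2.
apply: (exec_for_sum (r := Bits) (s := set_var s3 bit3 i')
  (G := level_term k B i j i')) => j' s4 _ fr4.
have [in_s4 hB4] : ready s4 := keep_ready _ _ _ fr4 isT not_src ready3.
have := @exec_gather_level src k B (set_var s4 bit4 j') src_gt in_s4 hB4.
have [fv2 _] := fr2; have [fv3 _] := fr3; have [fv4 _] := fr4.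
have -> : var (set_var s4 bit4 j') bit1 = i.
  by rewrite /= /upd /= fv4 //= /upd /= fv3 //= /upd /= fv2.
have -> : var (set_var s4 bit4 j') bit2 = j.
  by rewrite /= /upd /= fv4 //= /upd /= fv3.
by have -> : var (set_var s4 bit4 j') bit3 = i' by rewrite /= /upd /= fv4.
Qed.

Lemma exec_gather_corner src k B s : (n < 2 ^ L)%N -> (gathered < src)%N ->
  reads_input s -> holds src B s ->
  forall p q, (p < n)%N -> (q < n)%N ->
  (tab (exec (gather_corner src k) s) gathered p q)%:R =
    (tab s gathered p q)%:R + (-1) ^+ corner_sign k * corner_quadrant n y k B p q.
Proof.
move=> n_lt src_gt in_s hB p q pn qn.
rewrite (exec_gather_corner_levels _ src_gt in_s hB) //; congr (_ + _).
have thr_lt p' q' thr : (p' < n -> q' < n -> threshold_value n p' q' thr < 2 ^ L)%N.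
  by move=> pn' qn'; apply: leq_ltn_trans n_lt; apply: threshold_value_le.
rewrite /corner_quadrant (@quadrant_levels _ _ _ L) ?thr_lt ?y_lt // mulr_sumr.
apply: eq_bigr => i _; rewrite mulr_sumr; apply: eq_bigr => j _.
by rewrite mulr_sumr; apply: eq_bigr => i' _; rewrite mulr_sumr.
Qed.

End RingPasses.
End Passes.

(** * Solving one relaxed counting problem *)

Definition bag_table i := 5 + i.

Definition gather_edge tau t i :=
  cseq (clear gathered ::
    [seq gather_corner (bag_table i) k
       | k <- corners tau (bag t i) (bag t (parent t i))]).

Definition absorb_bag tau t i :=
  Seq (gather_edge tau t i)
    (modify (bag_table (parent t i)) OpMul (Get gathered (Var point1) (Var point2))).

Definition agree_expr (u v : nat) (e1 e2 : expr) :=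
  if u < v then Op OpLt e1 e2 else Op OpLt e2 e1.

Definition indicator_expr tau (b : nat * nat) :=
  if b.1 == b.2 then Op OpEq (Var point1) (Var point2)
  else Op OpMul (agree_expr b.1 b.2 (Var point1) (Var point2))
         (agree_expr (nth 0 tau b.1) (nth 0 tau b.2)
            (height (Var point1)) (height (Var point2))).

Definition init_bag tau t i :=
  for_pairs Points
    (Put (bag_table i) (Var point1) (Var point2) (indicator_expr tau (bag t i))).

Definition sum_root :=
  Seq (Assign running_sum (Lit 0))
    (for_pairs Points (Assign running_sum
       (Op OpAdd (Var running_sum) (Get (bag_table 0) (Var point1) (Var point2))))).

Definition relaxed_cmd tau t := cseq
  ([seq init_bag tau t i | i <- iota 0 (size t)] ++
   [seq absorb_bag tau t i | i <- rev (iota 1 (size t).-1)] ++ [:: sum_root]).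

Lemma hasN_map (S T : Type) (f : S -> T) (P : pred T) (s : seq S) :
  (forall x, ~~ P (f x)) -> ~~ has P (map f s).
Proof. by move=> fP; rewrite has_map; elim: s => //= x s IH; rewrite negb_or fP. Qed.

Lemma gather_edge_puts tau t i v : gathered < v -> ~~ puts (gather_edge tau t i) v.
Proof.
move=> hv; rewrite puts_cseq; move: (corners _ _ _) => ks; rewrite /= negb_or.
by rewrite ltn_eqF // hasN_map // => k; rewrite /= !ltn_eqF // (leq_trans _ hv).
Qed.

Lemma gather_edge_assigns tau t i v :
  running_sum <= v -> ~~ assigns (gather_edge tau t i) v.
Proof.
move=> hv; rewrite assigns_cseq; move: (corners _ _ _) => ks; rewrite /= negb_or.
rewrite !ltn_eqF ?(leq_trans _ hv) // hasN_map // => k.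
by rewrite /= !ltn_eqF // (leq_trans _ hv).
Qed.

Lemma relaxed_cmd_assigns tau t v :
  running_sum < v -> ~~ assigns (relaxed_cmd tau t) v.
Proof.
move=> hv; rewrite assigns_cseq !has_cat !negb_or.
have not_v v' : v' <= running_sum -> v' == v = false.
  by move=> v'_le; rewrite ltn_eqF // (leq_ltn_trans v'_le).
rewrite !hasN_map ?not_v // => i; last by rewrite /= !not_v.
by apply/norP; split; [apply: gather_edge_assigns (ltnW hv) | rewrite /= !not_v].
Qed.

Lemma relaxed_cmd_puts tau t : ~~ puts (relaxed_cmd tau t) input.
Proof. by rewrite puts_cseq !has_cat !negb_or !hasN_map. Qed.

Section RelaxedCount.
Variables (w n L k : nat) (pi : 'S_n).
Local Notation y := (extend pi).
Local Notation exec := (exec w n L).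
Local Notation eval := (eval w n L).
Local Notation reads_input := (reads_input n y).
Hypothesis wide : n.+2 < 2 ^ w.
Hypothesis n_lt : n < 2 ^ L.
Local Open Scope ring_scope.
Variable R : comNzRingType.
Hypothesis word_zero : (2 ^ w)%N%:R = 0 :> R.
Local Notation holds := (@holds n R).

Let y_lt r : (r < n)%N -> (y r < n)%N. Proof. exact: extend_lt. Qed.

Lemma exec_gather_corners src (B : nat -> nat -> R) (ks : seq corner) s :
  (gathered < src)%N -> reads_input s -> holds src B s ->
  forall p q, (p < n)%N -> (q < n)%N ->
  (tab (exec (cseq [seq gather_corner src c | c <- ks]) s) gathered p q)%:R =
  (tab s gathered p q)%:R +
  \sum_(c <- ks) (-1) ^+ corner_sign c * corner_quadrant n y c B p q.
Proof.
move=> src_gt; elim: ks s => [|c ks IH] s in_s hB p q pn qn.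
  by rewrite exec_nil big_nil addr0.
have fr := exec_frame w n L (gather_corner src c) s.
have not_src : ~~ puts (gather_corner src c) src.
  by rewrite /= !ltn_eqF // (ltn_trans _ src_gt).
rewrite exec_cons IH //; last 2 first.
- exact: frame_reads_input fr isT in_s.
- exact: frame_holds fr not_src hB.
rewrite big_cons addrA; congr (_ + _).
exact: (exec_gather_corner wide y_lt word_zero _ n_lt src_gt in_s hB).
Qed.

Section Tree.
Variables (tau : seq nat) (t : bag_tree).
Hypothesis tau_perm : perm_eq tau (iota 0 k).
Hypothesis wft : well_formed k t.
Implicit Types (A : nat -> nat -> nat -> R) (s : store).

Definition stored m A s := forall j, (j < m)%N -> holds (bag_table j) (A j) s.

Lemma nth_tau_eq l l' : (l < k)%N -> (l' < k)%N ->
  (nth 0%N tau l == nth 0%N tau l') = (l == l').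
Proof.
move=> lk lk'; have sz : size tau = k by rewrite (perm_size tau_perm) size_iota.
by rewrite nth_uniq ?sz // (perm_uniq tau_perm) iota_uniq.
Qed.

Lemma parent_avoids i l : (0 < i < size t)%N -> l \in bag_labels (bag t i) ->
  avoids tau (bag t (parent t i)) l.
Proof.
move=> hi; have /andP[_ it] := hi; have pi_lt := parent_lt wft hi.
have /andP[c1 c2] := bag_lt wft (ltn_trans pi_lt it).
have /andP[c1_in c2_in] := bag_in_prefix t pi_lt; move=> lb.
have lk : (l < k)%N.
  have /andP[b1 b2] := bag_lt wft it.
  move: lb; rewrite /bag_labels.
  by case: eqP => _; rewrite !inE; [|case/orP]; move/eqP->.
have ne l' : l' \in prefix_labels t i -> l != l'.
  by move=> l'_in; apply: contraTneq lb => ->; exact: (prefix_disjoint wft it).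
by rewrite /avoids !nth_tau_eq // !ne.
Qed.

Lemma exec_gather_edge i B s : (0 < i < size t)%N -> reads_input s ->
  holds (bag_table i) B s ->
  forall p q, (p < n)%N -> (q < n)%N -> bag_ok tau y (bag t (parent t i)) p q ->
  (tab (exec (gather_edge tau t i) s) gathered p q)%:R = aggregate n tau y t i B p q.
Proof.
move=> hi in_s hB p q pn qn c_ok; have /andP[_ it] := hi.
have fr := exec_frame w n L (clear gathered) s.
rewrite exec_cons (exec_gather_corners (B := B)) //; last 2 first.
- exact: frame_reads_input fr isT in_s.
- exact: (frame_holds fr _ hB).
rewrite exec_clear ?(ltnW pn) ?(ltnW qn) // add0r /aggregate.
have /andP[c1 c2] := bag_lt wft (ltn_trans (parent_lt wft hi) it).
have /andP[b1 b2] := mem_bag_labels (bag t i).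
by rewrite corners_sum ?parent_avoids // nth_tau_eq.
Qed.

Lemma exec_absorb_bag A i s : (0 < i < size t)%N -> reads_input s ->
  supported tau y t A -> stored i.+1 A s ->
  stored i (absorb n tau y t A i) (exec (absorb_bag tau t i) s).
Proof.
move=> hi in_s suppA hA; have /andP[i0 it] := hi; have pi_lt := parent_lt wft hi.
rewrite execE; set s1 := exec (gather_edge tau t i) s => j ji.
have tab1 j' : tab s1 (bag_table j') = tab s (bag_table j').
  by apply: exec_tab; apply: gather_edge_puts.
rewrite /absorb; case: (eqVneq j (parent t i)) => [->|ne] p q; last first.
  by move=> pn qn; rewrite exec_tab /= ?orbF ?eqn_add2l 1?eq_sym // tab1 hA // ltnW.
move: p q; apply: (exec_modify (Q := fun p q v => v%:R =
  A (parent t i) p q * aggregate n tau y t i (A i) p q)).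
move=> p q s2 pn qn s2p s2q [_ ft2].
rewrite (natr_OpMul word_zero) tab1 hA // 1?(ltn_trans pi_lt) // !evalE s2p s2q.
rewrite !modn_small ?ltnS ?(ltnW pn) ?(ltnW qn) // ft2 //.
have [c_ok|not_ok] := boolP (bag_ok tau y (bag t (parent t i)) p q).
  by rewrite (exec_gather_edge hi in_s (hA i _)).
by rewrite suppA ?mul0r // (ltn_trans pi_lt).
Qed.

Lemma exec_absorb_bags m A s : (m < size t)%N -> reads_input s ->
  supported tau y t A -> stored m.+1 A s ->
  let s' := exec (cseq [seq absorb_bag tau t i | i <- rev (iota 1 m)]) s in
  exists2 A', supported tau y t A' &
    stored 1 A' s' /\ total n tau y t A' 1 = total n tau y t A m.+1.
Proof.
elim: m A s => [|m IH] A s mt in_s suppA hA; first by exists A.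
have hm : (0 < m.+1 < size t)%N by [].
rewrite -[X in iota _ X]addn1 iotaD rev_cat /= exec_cons add1n.
have fr := exec_frame w n L (absorb_bag tau t m.+1) s.
have [|A' suppA' [hA' tot]] :=
  IH _ _ (ltnW mt) _ (absorb_supported _ _ suppA) (exec_absorb_bag hm in_s suppA hA).
  exact: frame_reads_input fr isT in_s.
by exists A' => //; split=> //; rewrite tot (totalS _ wft hm).
Qed.

Lemma modn_word_bool (c : bool) : (c %% 2 ^ w)%N = c.
Proof. by rewrite (modn_word_small wide) // (leq_trans (leq_b1 c)). Qed.

Lemma eval_agree_expr s (u v : nat) e1 e2 a b : eval s e1 = a -> eval s e2 = b ->
  eval s (agree_expr u v e1 e2) = agree u v a b.
Proof.
rewrite /agree_expr /agree => <- <-.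
by case: ifP => _; rewrite evalE /eval_binop modn_word_bool.
Qed.

Lemma eval_indicator_expr s (b : nat * nat) p q :
  reads_input s -> (p < n)%N -> (q < n)%N ->
  var s point1 = p -> var s point2 = q ->
  eval s (indicator_expr tau b) = bag_ok tau y b p q.
Proof.
move=> in_s pn qn sp sq; rewrite /indicator_expr /bag_ok; case: ifP => _.
  by rewrite !evalE sp sq /eval_binop modn_word_bool.
have xp : eval s (Var point1) = p by [].
have xq : eval s (Var point2) = q by [].
have yp := eval_height wide y_lt in_s xp pn.
have yq := eval_height wide y_lt in_s xq qn.
rewrite evalE (eval_agree_expr _ _ xp xq) (eval_agree_expr _ _ yp yq).
by rewrite /eval_binop mulnb modn_word_bool.
Qed.

Lemma exec_init_bags m s : reads_input s ->
  stored m (bag_indicator R tau y t)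
    (exec (cseq [seq init_bag tau t i | i <- iota 0 m]) s).
Proof.
move=> in_s; elim: m => [|m IH] //.
rewrite -[X in iota _ X]addn1 iotaD map_cat exec_cat /= exec_cons exec_nil add0n.
set s1 := exec _ s in IH *; have in_s1 : reads_input s1.
  apply: frame_reads_input (exec_frame _ _ _ _ _) _ in_s.
  by rewrite puts_cseq hasN_map.
move=> j; rewrite ltnS leq_eqVlt => /orP[/eqP->|jm] p q pn qn; last first.
  by rewrite exec_tab ?IH //= eqn_add2l gtn_eqF.
move: p q pn qn; apply: (@exec_for_pairs_map _ _ _ Points _ _
  (fun p q v => v%:R = bag_indicator R tau y t m p q)) => //.
move=> p q s2 pn qn s2p s2q fr _.
rewrite (eval_indicator_expr _ _ pn qn) //; exact: frame_reads_input fr isT in_s1.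
Qed.

Lemma exec_sum_root s : (var (exec sum_root s) running_sum)%:R =
  \sum_(p < n) \sum_(q < n) (tab s (bag_table 0) p q)%:R :> R.
Proof.
rewrite execE; set s1 := exec (Assign _ _) s; set c := for_pairs _ _.
pose P a b s' := (var s' running_sum)%:R =
  \sum_(p < a) \sum_(q < n) (tab s (bag_table 0) p q)%:R +
  \sum_(q < b) (tab s (bag_table 0) a q)%:R :> R.
have : P n 0%N (exec c s1).
  apply: (exec_for_pairs_ind (P := P) (r := Points)) => //
    [|a b s' v x|a b s' an bn s'a s'b [_ ft] Pab|a s' an Pa].
  - by rewrite /P !big_ord0 addr0 /s1 execE evalE /= /upd /= mod0n.
  - by rewrite !inE => /orP[] /eqP->.
  - rewrite /P execE /= /upd /= evalE (natr_OpAdd word_zero) Pab.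
    rewrite big_ord_recr addrA /=.
    by rewrite !evalE s'a s'b !modn_small ?ltnS ?(ltnW an) ?(ltnW bn) // ft.
  - by rewrite /P big_ord0 addr0 big_ord_recr.
by rewrite /P big_ord0 addr0.
Qed.

Lemma exec_relaxed_cmd s : (0 < size t)%N -> reads_input s ->
  (var (exec (relaxed_cmd tau t) s) running_sum)%:R =
    (relaxed_count k tau t pi)%:R :> R.
Proof.
move=> t0 in_s; rewrite /relaxed_cmd !exec_cat.
set s1 := exec _ s; set s2 := exec _ s1; rewrite exec_cons exec_nil exec_sum_root.
have in_s1 : reads_input s1.
  apply: frame_reads_input (exec_frame _ _ _ _ _) _ in_s.
  by rewrite puts_cseq hasN_map.
have stored_s1 : stored (size t).-1.+1 (bag_indicator R tau y t) s1.
  by rewrite prednK //; apply: exec_init_bags.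
have lt_t : ((size t).-1 < size t)%N by rewrite prednK.
have [A' suppA' [hA' tot]] :=
  exec_absorb_bags lt_t in_s1 (@bag_indicator_supported R tau y t) stored_s1.
rewrite -(total_bag_indicator R tau pi wft) -[X in total _ _ _ _ _ X](prednK t0).
rewrite -tot (total1 _ t0 suppA').
by apply: eq_bigr => p _; apply: eq_bigr => q _; apply: hA'.
Qed.

End Tree.
End RelaxedCount.

(** * Solving a triangular system *)

Definition octal_key (s : seq nat) : positive :=
  foldl (fun x d => Pos.add (Pos.mul 8 x) (Pos.of_succ_nat d)) xH s.

(* The map stores the permutations themselves, so that nothing has to be proved
   about the keys. *)
Definition solved (m : PositiveMap.t (seq nat)) (s : seq nat) :=
  if PositiveMap.find (octal_key s) m is Some s' then s' == s else false.

Definition solvable k m (e : seq nat * bag_tree) :=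
  let: (tau, t) := e in
  let L := patterns k tau t in
  [&& perm_eq tau (iota 0 k), well_formed k t, separated k tau t, tau \in L
    & all (solved m) (rem tau L)].

Fixpoint triangular k m (es : seq (seq nat * bag_tree)) :=
  if es is e :: es' then
    solvable k m e && triangular k (PositiveMap.add (octal_key e.1) e.1 m) es'
  else all (solved m) (linear_extensions [::] (iota 0 k)).

Definition count_var (s : seq nat) := running_sum.+1 + pickle s.

Definition sum_expr (es : seq expr) := foldr (Op OpAdd) (Lit 0) es.

Definition solve_entry k (e : seq nat * bag_tree) :=
  let: (tau, t) := e in
  Seq (relaxed_cmd tau t)
    (Assign (count_var tau) (Op OpSub (Var running_sum)
       (sum_expr [seq Var (count_var s) | s <- rem tau (patterns k tau t)]))).

Definition solve_all k es := cseq [seq solve_entry k e | e <- es].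

Lemma count_var_inj : injective count_var.
Proof. by move=> p q /addnI/(pcan_inj pickleK). Qed.

Lemma natr_Zp_inj m a b : 1 < m -> a < m -> b < m -> (a%:R = b%:R :> 'Z_m)%R -> a = b.
Proof. by move=> m1 am bm /(congr1 val); rewrite /= !val_Zp_nat // !modn_small. Qed.

Lemma solved_add s s' m : solved (PositiveMap.add (octal_key s) s m) s' ->
  s' = s \/ solved m s'.
Proof.
rewrite /solved PositiveMapAdditionalFacts.gsspec.
by case: PositiveMap.E.eq_dec => _; [move/eqP=> ->; left | right].
Qed.

Section Solving.
Variables (w n L k : nat) (pi : 'S_n).
Local Notation exec := (exec w n L).
Local Notation reads_input := (reads_input n (extend pi)).
Hypothesis wide : n.+2 < 2 ^ w.
Hypothesis count_lt : n ^ k < 2 ^ w.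
Hypothesis n_lt : n < 2 ^ L.
Hypothesis k_gt0 : 0 < k.

Definition known s p := var s (count_var p) = one_line_pattern_count k pi p.

Lemma eval_sum_expr s l : (forall p, p \in l -> known s p) ->
  eval w n L s (sum_expr [seq Var (count_var p) | p <- l]) =
  (\sum_(p <- l) one_line_pattern_count k pi p) %% 2 ^ w.
Proof.
elim: l => [|p l IH] kn; first by rewrite evalE big_nil.
rewrite evalE IH => [|q ql]; last by apply: kn; rewrite inE ql orbT.
by rewrite /eval_binop modnDmr evalE kn ?mem_head // big_cons.
Qed.

Lemma exec_solve_entry s tau t m (s' := exec (solve_entry k (tau, t)) s) :
  solvable k m (tau, t) -> reads_input s -> (forall p, solved m p -> known s p) ->
  [/\ reads_input s', known s' tau & forall p, p != tau -> known s p -> known s' p].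
Proof.
move=> /and5P[tau_perm wft sep tau_in /allP solved_rem] in_s kn.
rewrite /s' execE {s'}; set s1 := exec (relaxed_cmd tau t) s; set c := Assign _ _.
have fr1 : frame (relaxed_cmd tau t) s s1 := exec_frame _ _ _ _ _.
have known1 p : known s p -> known s1 p.
  case: fr1 => fv _; rewrite /known fv //; apply: relaxed_cmd_assigns.
  exact: leq_addr.
split.
- have in_s1 := frame_reads_input fr1 (relaxed_cmd_puts tau t) in_s.
  exact: frame_reads_input (exec_frame w n L c s1) isT in_s1.
- have w1 : 1 < 2 ^ w by apply: leq_ltn_trans wide.
  have word_zero : ((2 ^ w)%N%:R = 0 :> 'Z_(2 ^ w))%R.
    by apply: val_inj; rewrite /= val_Zp_nat // modnn.
  rewrite /known execE /= /upd eqxx evalE eval_sum_expr; last first.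
    by move=> p /solved_rem/kn/known1.
  apply: (natr_Zp_inj w1); first by rewrite ltn_pmod // expn_gt0.
    exact: leq_ltn_trans (one_line_pattern_count_le _ tau_perm) count_lt.
  rewrite (natr_OpSub word_zero) ?(natr_word word_zero); last first.
    by rewrite ltnW // ltn_pmod // expn_gt0.
  have t_gt0 := size_well_formed wft k_gt0.
  rewrite evalE (exec_relaxed_cmd wide n_lt word_zero tau_perm wft t_gt0 in_s).
  rewrite (relaxed_countE _ wft sep) (perm_big _ (perm_to_rem tau_in)) big_cons natrD.
  by rewrite addrK.
- move=> p ne /known1; rewrite /known execE /= /upd (inj_eq count_var_inj).
  by rewrite (negPf ne).
Qed.

Lemma exec_solve_all m es s : triangular k m es -> reads_input s ->
  (forall p, solved m p -> known s p) ->
  forall p, perm_eq p (iota 0 k) -> known (exec (solve_all k es) s) p.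
Proof.
elim: es m s => [|[tau t] es IH] m s.
  move=> /= /allP solved_all in_s kn p pp; apply: kn; apply: solved_all.
  by rewrite mem_linear_extensions ?iota_uniq.
rewrite [triangular _ _ _]/= => /andP[ok_e ok_es] in_s kn.
have [in_s1 kn_tau kn1] := exec_solve_entry ok_e in_s kn.
rewrite /solve_all [map _ _]/= exec_cons; apply: IH ok_es in_s1 _ => p /solved_add.
have [-> //|ne] := eqVneq p tau.
by case=> [/eqP|/kn/kn1]; [rewrite (negPf ne) | apply].
Qed.

End Solving.

(** * Running time *)

Fixpoint nest_le d l (c : cmd) : bool :=
  match c with
  | Seq c1 c2 => nest_le d l c1 && nest_le d l c2
  | For _ Bits c => if l is l'.+1 then nest_le d l' c else false
  | For _ _ c => if d is d'.+1 then nest_le d' l c else false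
  | _ => true
  end.

Fixpoint cmd_weight (c : cmd) : nat :=
  match c with
  | Assign _ e => expr_cost e + 1
  | Put _ e1 e2 e => expr_cost e1 + expr_cost e2 + 7 + expr_cost e + 1
  | Skip => 0
  | Seq c1 c2 => cmd_weight c1 + cmd_weight c2
  | For _ _ c => cmd_weight c + 9
  end.

Lemma cost_le n L d l c : nest_le d l c ->
  cost n L c <= cmd_weight c * (n.+1 ^ d * L.+1 ^ l).
Proof.
have nest_gt0 d' l' : 0 < n.+1 ^ d' * L.+1 ^ l' by rewrite muln_gt0 !expn_gt0.
elim: c d l => [v e|t e1 e2 e||c1 IH1 c2 IH2|v r c IH] d l /=.
- by rewrite leq_pmulr.
- by rewrite leq_pmulr.
- by [].
- by case/andP=> n1 n2; rewrite mulnDl leq_add ?IH1 ?IH2.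
have loop N d' l' : nest_le d' l' c ->
    N.+1 * (n.+1 ^ d' * L.+1 ^ l') = n.+1 ^ d * L.+1 ^ l -> forall m, m <= N.+1 ->
    m * (cost n L c + 6) + 3 <= (cmd_weight c + 9) * (n.+1 ^ d * L.+1 ^ l).
  move=> /IH; move: (cost n L c) (cmd_weight c) (nest_gt0 d' l') => C S + + <- m; nia.
case: r; [case: d loop => // d | case: d loop => // d | case: l loop => // l];
  move=> loop hc.
- by apply: loop hc _ _ (leqnSn n); rewrite expnS mulnA.
- by apply: loop hc _ _ (leqnn _); rewrite expnS mulnA.
- by apply: loop hc _ _ (leqnSn L); rewrite expnS mulnCA.
Qed.

Lemma nest_le_cseq d l s : nest_le d l (cseq s) = all (nest_le d l) s.
Proof. by elim: s => //= c s <-. Qed.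

Lemma all_mapT (S T : Type) (f : S -> T) (P : pred T) (s : seq S) :
  (forall x, P (f x)) -> all P (map f s).
Proof. by move=> fP; elim: s => //= x s ->; rewrite fP. Qed.

Lemma relaxed_cmd_nest_le tau t : nest_le 2 4 (relaxed_cmd tau t).
Proof. by rewrite nest_le_cseq !all_cat !all_mapT. Qed.

Lemma solve_all_nest_le k es : nest_le 2 4 (solve_all k es).
Proof.
rewrite nest_le_cseq; apply: all_mapT => -[tau t].
by rewrite -[nest_le _ _ _]/(nest_le 2 4 (relaxed_cmd tau t) && true)
  relaxed_cmd_nest_le.
Qed.

(** * The whole algorithm *)

Definition count_bits :=
  Seq (Assign running_sum (Lit 0))
    (For point1 Points (Assign running_sum (Op OpAdd (Var running_sum)
       (Op OpLt (Lit 0) (Op OpShr (Size Points) (Var point1)))))).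

Definition bit_count n := \sum_(j < n) (0 < n %/ 2 ^ j).

Lemma bit_countE n : bit_count n = (0 < n) * (trunc_log 2 n).+1.
Proof.
rewrite /bit_count; case: (posnP n) => [->|n0]; first by rewrite big_ord0.
have /andP[lo hi] := trunc_log_bounds (isT : 1 < 2) n0.
have log_lt : trunc_log 2 n < n by apply: leq_trans lo; apply: ltn_expl.
rewrite -(big_mkord xpredT (fun j => (0 < n %/ 2 ^ j) : nat)).
rewrite (big_cat_nat (leq0n _) log_lt) /=.
rewrite (eq_big_nat _ _ (F2 := fun=> 1)) => [|j /andP[_ j_le]]; last first.
  by rewrite divn_gt0 ?expn_gt0 // (leq_trans _ lo) // leq_exp2l // -ltnS.
rewrite [X in _ + X]big_nat_cond [X in _ + X]big1 => [|j /andP[/andP[j_gt _] _]].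
  by rewrite sum_nat_const_nat subn0 muln1 addn0 mul1n.
by rewrite divn_small // (leq_trans hi) // leq_exp2l.
Qed.

Lemma bit_count_lt n : n < 2 ^ bit_count n.
Proof.
rewrite bit_countE; case: (posnP n) => [->//|n0]; rewrite mul1n.
by case/andP: (trunc_log_bounds (isT : 1 < 2) n0).
Qed.

Lemma bit_count_le n : bit_count n <= n.
Proof.
apply: (@leq_trans (\sum_(j < n) 1)); last by rewrite sum1_card card_ord.
by apply: leq_sum => j _; apply: leq_b1.
Qed.

Lemma exec_count_bits w n L s : n.+2 < 2 ^ w ->
  var (exec w n L count_bits s) running_sum = bit_count n.
Proof.
move=> wide; rewrite execE.
pose P k s' := var s' running_sum = \sum_(j < k) (0 < n %/ 2 ^ j).
apply: (exec_for_ind (P := P)) => [|k s' kn fr Pk].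
  by rewrite /P big_ord0 execE evalE /= /upd /= mod0n.
have sum_le : var s' running_sum <= n.
  rewrite Pk; apply: (@leq_trans (\sum_(j < k) 1)).
    by apply: leq_sum => j _; apply: leq_b1.
  by rewrite sum1_card card_ord ltnW.
rewrite /P execE /= /upd /= big_ord_recr -Pk !evalE /= /upd /= mod0n /eval_binop.
rewrite (modn_word_le wide (leq_div n _)) (modn_word_bool wide).
rewrite (modn_word_small wide) //.
by apply: leq_trans (leq_add sum_le (leq_b1 _)) _; rewrite addn1.
Qed.

Fixpoint output_code j (l : seq nat) : program :=
  if l is r :: l' then [:: Const (tmp 0) j, StoreM (tmp 0) r & output_code j.+1 l']
  else [::].

Lemma size_output_code j l : size (output_code j l) = (size l).*2.
Proof. by elim: l j => //= r l IH j; rewrite IH. Qed.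

Lemma effects_output_code w sp l j R M : j + size l <= sp -> sp <= 2 ^ w ->
  all (fun r => tmp 0 != r) l ->
  safe w sp (R, M) (output_code j l) /\ exists R' M',
    [/\ effects w (R, M) (output_code j l) = (R', M'),
        forall i, i < size l -> M' (j + i) = R (nth 0 l i) &
        forall a, a < j -> M' a = M a].
Proof.
elim: l j R M => [|r l IH] j R M; first by split=> //; exists R, M.
rewrite [size _]/= => j_le sp_le /andP[ne_r ne_l].
have j_lt : j < sp by rewrite (leq_trans _ j_le) // -addSnnS leq_addr.
have j_w : j %% 2 ^ w = j by rewrite modn_small // (leq_trans j_lt).
pose R1 := upd R (tmp 0) (j %% 2 ^ w); pose M1 := upd M j (R r).
have R1r : R1 (tmp 0) = j by rewrite /R1 /upd eqxx.
have const_j : effect w (R, M) (Const (tmp 0) j) = (R1, M) by rewrite effectE.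
have store_r : effect w (R1, M) (StoreM (tmp 0) r) = (R1, M1).
  by rewrite effectE R1r /R1 /upd eq_sym (negPf ne_r).
have [|safe_l [R' [M' [eff_l out_l keep_l]]]] := IH j.+1 R1 M1 _ sp_le ne_l.
  by rewrite addSnnS.
split.
  rewrite [output_code _ _]/= 2![safe _ _ _ _]/= const_j store_r safe_l andbT.
  by rewrite -[touched _ _]/(R1 (tmp 0)).+1 R1r.
exists R', M'; split.
- by rewrite /effects /= const_j store_r.
- case=> [_|i i_lt]; first by rewrite addn0 keep_l // /M1 /upd eqxx.
  rewrite -addSnnS out_l //= /R1 /upd eq_sym; move: (all_nthP 0 ne_l i i_lt).
  by move/negPf->.
- by move=> a aj; rewrite keep_l 1?ltnW // /M1 /upd ltn_eqF.
Qed.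

Definition startup : program :=
  [:: Const (tmp 0) 1; Binop OpAdd (range_reg Cells) (range_reg Points) (tmp 0)].

Definition prelude : program :=
  startup ++ compile 2 0 count_bits ++
    [:: Move (range_reg Bits) (var_reg running_sum)].

Definition count_regs k := [seq var_reg (count_var (one_line tau)) | tau : 'S_k].

Definition profile_program k es : program :=
  let solve := compile (size prelude) 0 (solve_all k es) in
  prelude ++ solve ++ output_code 0 (count_regs k).

Definition profile_time k es n :=
  3 + cost n 0 count_bits + cost n (bit_count n) (solve_all k es) + #|{: 'S_k}|.*2.

Definition profile_space k es n :=
  table_count (solve_all k es) * n.+1 * n.+1 + #|{: 'S_k}|.

Lemma size_perm_vector n (pi : 'S_n) : size (perm_vector pi) = n.
Proof. by rewrite size_map -cardE card_ord. Qed.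

Lemma nth_perm_vector n (pi : 'S_n) r :
  r < n -> nth 0 (perm_vector pi) r = (extend pi r).+1.
Proof.
move=> rn; rewrite (nth_map (Ordinal rn)) ?size_enum_ord //.
rewrite -[r in nth _ _ r]/(val (Ordinal rn)) nth_ord_enum.
by rewrite -[r in extend pi r]/(val (Ordinal rn)) extendE.
Qed.

Lemma word_size_fits C e n : C * n.+1 ^ e < 2 ^ word_size (C + e) n.
Proof.
rewrite /word_size [X in 2 ^ X]mulnC expnM expnD; set u := 2 ^ _.+1.
have nu : n < u := trunc_log_ltn n (isT : 1 < 2).
have u1 : 1 < u by rewrite -[1]/(2 ^ 0) ltn_exp2l.
apply: (@leq_trans (u ^ C * n.+1 ^ e)).
  by rewrite ltn_pmul2r ?expn_gt0 // ltn_expl.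
by case: e => // e; rewrite leq_mul2l leq_exp2r ?nu ?orbT.
Qed.

Section ProfileProgram.
Variables (k : nat) (es : seq (seq nat * bag_tree)) (n : nat) (pi : 'S_n) (w : nat).
Let T := table_count (solve_all k es).
Let L := bit_count n.
Let p := profile_program k es.
Let sp := profile_space k es n.
Hypothesis wide : n.+2 < 2 ^ w.
Hypothesis room : sp <= 2 ^ w.
Hypothesis count_lt : n ^ k < 2 ^ w.

Let room_tables : T * n.+1 * n.+1 <= 2 ^ w.
Proof. by apply: leq_trans room; apply: leq_addr. Qed.

Let tables_fit : T * n.+1 * n.+1 <= sp.
Proof. exact: leq_addr. Qed.

Let D_lt : n.+1 < 2 ^ w.
Proof. exact: ltnW wide. Qed.

Lemma runs_prelude : code_at p 0 prelude -> exists s R M,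
  [/\ runs w p sp (init_state (perm_vector pi)) (3 + cost n 0 count_bits)
        (State (size prelude) R M),
      represents n L T s R M & reads_input n (extend pi) s].
Proof.
case/code_at_cat=> startup_at /code_at_cat[count_at /code_at_cons[move_at _]].
pose M := nth 0 (perm_vector pi).
pose R := upd (upd (upd (fun=> 0) 0 n) (tmp 0) 1) (range_reg Cells) n.+1.
pose s := Store (fun=> 0) (fun t x z => M (addr n t x z)).
have start : runs w p sp (init_state (perm_vector pi)) 2 (State 2 R M).
  apply: (runs_straight startup_at) => //.
  rewrite /effects /= !effectE size_perm_vector (modn_word_small wide (a := 1)) //.
  by rewrite -[eval_binop _ _ _ _]/((n + 1) %% 2 ^ w) addn1 (modn_word_small wide).
have rep : represents n 0 T s R M.
  split=> // [[]|v] //; rewrite /R /upd ![var_reg v == _]eq_sym.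
  by rewrite range_neq_var tmp_neq_var (range_neq_var Points).
have in_s : reads_input n (extend pi) s.
  by move=> r rn; rewrite /= /addr !mul0n !add0n /M nth_perm_vector.
have [R1 [M1 [run1 rep1 _]]] := compile_simulated room_tables tables_fit D_lt
  (leq0n n) (leq0n T : table_count count_bits <= T) count_at rep.
set s1 := exec _ _ _ _ _ in rep1.
have s1_bits : var s1 running_sum = L := exec_count_bits 0 s wide.
have [size1 var1 M1_tab] := rep1; exists s1, (upd R1 (range_reg Bits) L), M1; split.
- have -> : 3 + cost n 0 count_bits = 2 + (cost n 0 count_bits + 1) by lia.
  apply: (runs_trans start); apply: (runs_trans run1).
  apply: (runs_instr move_at) => //.
  by rewrite effectE var1 s1_bits.
- split=> //= [r|v]; rewrite /upd; last by rewrite eq_sym (range_neq_var Bits) var1.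
  by have := size1 r; case: r.
- exact: (frame_reads_input (exec_frame w n 0 count_bits s)).
Qed.

Lemma profile_program_computes : 0 < k -> triangular k (PositiveMap.empty _) es ->
  computes w p (perm_vector pi) (profile k pi) (profile_time k es n) sp.
Proof.
move=> k_gt0 es_triangular.
have /code_at_cat[prelude_at /code_at_cat[solve_at output_at]] : code_at p 0 p by [].
have [s [R [M [run1 rep in_s]]]] := runs_prelude prelude_at.
have [R1 [M1 [run2 [_ var1 _] _]]] := compile_simulated room_tables tables_fit D_lt
  (bit_count_le n) (leqnn T) solve_at rep.
set s1 := exec _ _ _ _ _ in var1.
have known_s1 := exec_solve_all wide count_lt (bit_count_lt n) k_gt0 es_triangular in_s.
have solved_s1 (tau : 'S_k) :
    var s1 (count_var (one_line tau)) = pattern_count tau pi.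
  rewrite -one_line_pattern_countE; apply: known_s1 (perm_one_line tau) => q.
  by rewrite /solved PositiveMap.gempty.
have size_regs : size (count_regs k) = #|{: 'S_k}| by rewrite size_map -cardE.
have [||safe_out [R2 [M2 [eff_out out _]]]] :=
  @effects_output_code w sp (count_regs k) 0 R1 M1 _ room.
- by rewrite add0n size_regs leq_addl.
- by apply/allP => _ /mapP[tau _ ->]; rewrite tmp_neq_var.
have := runs_trans (runs_trans run1 run2) (runs_straight output_at safe_out eff_out).
rewrite size_output_code size_regs => -[final touch].
exists (profile_time k es n); split; rewrite ?final //.
- rewrite /halted /fetch /= nth_default // !size_cat size_output_code size_regs.
  lia.
- by apply/bigmax_leqP => i _; apply: touch.
apply: (@eq_from_nth _ 0); rewrite size_mkseq // size_map -cardE => i i_lt.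
rewrite nth_mkseq // -[memory _ i]/(M2 (0 + i)) out ?size_regs //.
rewrite !(nth_map 1%g) -?enumT -?cardE //.
by rewrite var1 solved_s1.
Qed.

End ProfileProgram.

Definition word_factor k es := table_count (solve_all k es) + #|{: 'S_k}|.+2 + k.+2.

Lemma word_size_room k es n (w := word_size (word_factor k es) n) :
  [/\ n.+2 < 2 ^ w, profile_space k es n <= 2 ^ w & n ^ k < 2 ^ w].
Proof.
have fits := word_size_fits (table_count (solve_all k es) + #|{: 'S_k}|.+2) k.+2 n.
rewrite -/w expnSr expnSr -mulnA in fits; rewrite /profile_space -mulnA.
have nk : n ^ k <= n.+1 ^ k by case: (k) => // k'; rewrite leq_exp2r.
have : 0 < n.+1 ^ k by rewrite expn_gt0.
move: (table_count _) #|_| (n.+1 ^ k) nk fits => T S N nk fits N0.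
have D2 : n < n.+1 * n.+1 by nia.
have : n.+1 * n.+1 <= N * (n.+1 * n.+1) by rewrite leq_pmull.
have : N <= N * (n.+1 * n.+1) by rewrite leq_pmulr.
move: (n.+1 * n.+1) (N * _) D2 fits => D V; rewrite mulnDl => D2 fits VN VD.
have : T * D <= T * V by rewrite leq_mul2l VD orbT.
have : S <= S * V by rewrite leq_pmulr // (leq_trans N0).
split; nia.
Qed.

Lemma profile_time_softO k es : soft_O (profile_time k es) (fun n => n ^ 2).
Proof.
pose S := 3 + cmd_weight count_bits + cmd_weight (solve_all k es) + #|{: 'S_k}|.*2.
exists (S * (4 * 3 ^ 4)), 4, 2 => n n2.
have log_gt0 : 0 < trunc_log 2 n by rewrite trunc_log_gt0 n2.
pose V := n.+1 ^ 2 * (bit_count n).+1 ^ 4.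
have V_gt0 : 0 < V by rewrite muln_gt0 !expn_gt0.
have bits_cost : cost n 0 count_bits <= cmd_weight count_bits * V.
  apply: leq_trans (cost_le n 0 (isT : nest_le 2 4 count_bits)) _.
  by rewrite !leq_mul2l leq_exp2r ?orbT.
have solve_cost := cost_le n (bit_count n) (solve_all_nest_le k es).
have V_le : V <= 4 * n ^ 2 * (3 ^ 4 * trunc_log 2 n ^ 4).
  have n_le : n.+1 <= 2 * n by lia.
  have bits_le : (bit_count n).+1 <= 3 * trunc_log 2 n.
    by rewrite bit_countE (ltnW n2); lia.
  by rewrite -[4 * n ^ 2]/(2 ^ 2 * n ^ 2) -!expnMn leq_mul // leq_exp2r.
have const_le x : x <= x * V by rewrite leq_pmulr.
apply: (@leq_trans (S * V)).
  rewrite /profile_time /S 3!mulnDl.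
  apply: leq_add (const_le _); apply: leq_add solve_cost.
  exact: leq_add (const_le 3) bits_cost.
apply: leq_trans (leq_mul (leqnn S) V_le) _; apply: eq_leq; ring.
Qed.

Lemma profile_space_softO k es : soft_O (profile_space k es) (fun n => n ^ 2).
Proof.
exists (table_count (solve_all k es) * 4 + #|{: 'S_k}|), 0, 1 => n n1.
rewrite expn0 muln1 /profile_space mulnDl -!mulnA.
apply: leq_add; last by rewrite leq_pmulr // expn_gt0 n1.
by rewrite leq_mul2l; apply/orP; right; nia.
Qed.

Lemma profile_program_spec k es n (pi : 'S_n) :
  0 < k -> triangular k (PositiveMap.empty _) es ->
  computes (word_size (word_factor k es) n) (profile_program k es) (perm_vector pi)
    (profile k pi) (profile_time k es n) (profile_space k es n).
Proof.
by have [wide room count_lt] := word_size_room k es n; apply: profile_program_computes.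
Qed.

(** * Certificates *)

Fixpoint pair_up (s : seq nat) : seq (nat * nat) :=
  if s is a :: b :: s' then (a, b) :: pair_up s' else [::].

Definition hex_digits m (x : N) : seq nat :=
  rev [seq N.to_nat (x / 16 ^ N.of_nat i mod 16)%num | i <- iota 0 m].

(* An entry is a hexadecimal numeral: 1 if the bags form a star around the first
   one and 2 if they form a path, then tau in one-line notation, then the two
   labels of each bag. *)
Definition decode_entry k (x : N) : seq nat * bag_tree :=
  let digits := hex_digits (1 + k + (uphalf k).*2) x in
  let bags := pair_up (drop k (behead digits)) in
  (take k (behead digits),
   zip bags (if head 0 digits == 1 then nseq (size bags) 0
             else 0 :: iota 0 (size bags))).

Definition map_tree (f : nat -> nat) (t : bag_tree) : bag_tree :=
  [seq ((f b.1.1, f b.1.2), b.2) | b <- t].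

Definition inverse_entry k (e : seq nat * bag_tree) :=
  ([seq index i e.1 | i <- iota 0 k], map_tree (nth 0 e.1) e.2).

Definition reverse_entry k (e : seq nat * bag_tree) :=
  (rev e.1, map_tree (fun a => k.-1 - a) e.2).

Definition complement_entry k (e : seq nat * bag_tree) :=
  ([seq k.-1 - i | i <- e.1], e.2).

Definition square_orbit k e :=
  let s := [:: e; inverse_entry k e] in
  let s := s ++ map (reverse_entry k) s in
  s ++ map (complement_entry k) s.

Definition certificate k (c : seq N) :=
  flatten [seq square_orbit k (decode_entry k x) | x <- c].

Definition entries_S1 : seq N := [::
  0x1000]%num.

Definition entries_S2 : seq N := [::
  0x10101]%num.

Definition entries_S3 : seq N := [::
  0x10121200; 0x10211200]%num.

Definition entries_S4 : seq N := [::
  0x101232301; 0x101322301; 0x102132301; 0x102312301; 0x103212301;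
  0x110322301; 0x113022301]%num.

Definition entries_S5 : seq N := [::
  0x101234132400; 0x101243132400; 0x101324132400; 0x101342132400;
  0x101432132400; 0x102143243301; 0x102314132400; 0x102341243301;
  0x102413132400; 0x102431142300; 0x103214132400; 0x103241142300;
  0x103412132400; 0x103421142300; 0x104231142300; 0x104321243301;
  0x110243243301; 0x110342243301; 0x110432243301; 0x112403132400;
  0x113402132204; 0x113042243301; 0x114203023314]%num.

Definition entries_S6 : seq N := [::
  0x1012345243501; 0x1012354243501; 0x1012435243501; 0x1012453243501;
  0x1012543243501; 0x1013245234501; 0x1013254234501; 0x1013425243501;
  0x1013452253401; 0x1013524243501; 0x1013542253401; 0x1014325243501;
  0x1014352253401; 0x1014523243501; 0x1014532253401; 0x1015342253401;
  0x1015432253401; 0x1021354234501; 0x1021435243501; 0x1021453253401;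
  0x1021543253401; 0x1023154234501; 0x1023415243501; 0x1023451253401;
  0x1023514243501; 0x1023541253401; 0x1024351142305; 0x1024531142305;
  0x1025341142305; 0x1025431142305; 0x1032154134502; 0x1034512142305;
  0x1034521142305; 0x1035412142305; 0x1035421142305; 0x1042315142305;
  0x1043215142305; 0x1043521142305; 0x1045312034512; 0x1045321034512;
  0x1053421142305; 0x1054321253401; 0x1102354243501; 0x1102453243501;
  0x1102543243501; 0x1103254234501; 0x1103452253401; 0x1103524243501;
  0x1103542253401; 0x1104352253401; 0x1104523243501; 0x1104532253401;
  0x1105342253401; 0x1105432253401; 0x1120453253401; 0x1120534243501;
  0x1120543253401; 0x1123504243501; 0x1134502142305; 0x1135402142305;
  0x1140253134502; 0x1145302034512; 0x1210543253401; 0x1215043142305;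
  0x1240513142305; 0x1024135142503; 0x1024153142503; 0x1024315132504;
  0x1024513243501; 0x1025134142503; 0x1025143142503; 0x1025314132504;
  0x1025413132504; 0x1032451234501; 0x1034251253401; 0x1043251132405;
  0x1043512142503; 0x1052341042315; 0x1052431352401; 0x1124053142503;
  0x1124503132504; 0x1125034142503; 0x1125043142503; 0x1125304132504;
  0x1125403034512; 0x1130524052314; 0x1130542351402; 0x1132504142305;
  0x1143502142503; 0x1145023142305; 0x1032514253401; 0x1032541142305;
  0x1034125234501; 0x1034152234501; 0x1034215243501; 0x1035142234501;
  0x1035214243501; 0x1042351253401; 0x1042513142503; 0x1045231132405;
  0x1053241253401; 0x1134052234501; 0x1135024142503; 0x1135042152403;
  0x1135204142503; 0x1140352034512; 0x1140523143502; 0x1140532241305;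
  0x1142503034512; 0x1145032243501; 0x1145203134502; 0x1152304341502;
  0x1035241132405; 0x1042531241305; 0x1143052023514]%num.

Definition entries_S7 : seq N := [::
  0x2012345645361200; 0x2012346545361200; 0x2012354645361200;
  0x2012356445361200; 0x2012365445361200; 0x1012435625663401;
  0x2012436566352401; 0x2012453666452301; 0x2012456345361200;
  0x2012463546350211; 0x2012465345361200; 0x2012543666352401;
  0x2012546345361200; 0x2012563466352401; 0x2012564345361200;
  0x2012645345361200; 0x2012654345361200; 0x2013246556341200;
  0x2013254666452301; 0x2013256445361200; 0x2013265445361200;
  0x2013425666352401; 0x2013426566352401; 0x2013452646351200;
  0x2013456245361200; 0x2013462546351200; 0x2013465245361200;
  0x2013524666352401; 0x2013546234251600; 0x2013564234251600;
  0x2013624566352401; 0x2013645234251600; 0x2013654234251600;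
  0x2014325666352401; 0x1014326524563301; 0x2014365244352601;
  0x2014523666352401; 0x1014562325663401; 0x2014563234251600;
  0x1014652325663401; 0x2014653234251600; 0x1015342625663401;
  0x1015432625663401; 0x2015463234251600; 0x1015642314562300;
  0x2015643234251600; 0x2016345244352601; 0x2016453234251600;
  0x2016543245361200; 0x2021346545361200; 0x2021354645361200;
  0x2021356445361200; 0x2021365445361200; 0x2021436566352401;
  0x2021453646351200; 0x2021456345361200; 0x2021463546351200;
  0x2021465345361200; 0x2021543646351200; 0x2021546345361200;
  0x2021563446351200; 0x2021564345361200; 0x2021645345361200;
  0x2021654345361200; 0x2023146566452301; 0x2023156456241300;
  0x2023164566452301; 0x2023165456241300; 0x2023416566352401;
  0x2023456134251600; 0x2023465134251600; 0x2023514666352401;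
  0x2023546134251600; 0x2023564134251600; 0x2023614566352401;
  0x2023645134251600; 0x2023654134251600; 0x2024136556241300;
  0x2024563134251600; 0x2024653134251600; 0x2025136456241300;
  0x2025436133241506; 0x2025463134251600; 0x2025634133241506;
  0x2025643134251600; 0x2026134556241300; 0x2026135456241300;
  0x2026453134251600; 0x2026543134251600; 0x2032146555461302;
  0x2032156455461302; 0x2032165455461302; 0x2032564134251600;
  0x2032654134251600; 0x2034126556241300; 0x2034561233241506;
  0x2034562134251600; 0x2034651233241506; 0x2034652134251600;
  0x2035462166051423; 0x2035641233241506; 0x2035642133241506;
  0x2036452166051423; 0x2036541233241506; 0x2036542133241506;
  0x1042316514562300; 0x1043216514562300; 0x2043652133241506;
  0x1045612314562300; 0x1045613214562300; 0x2045631256041322;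
  0x2045632156041322; 0x1046513214562300; 0x2046531256041322;
  0x2046532156041322; 0x2052341633241506; 0x2054321633241506;
  0x2054632166051423; 0x2056431256041322; 0x2056432156041322;
  0x2062345134251600; 0x2062435134251600; 0x2063452133241506;
  0x2064532166051423; 0x2065342134251600; 0x2065432134251600;
  0x2102346545361200; 0x2102356445361200; 0x2102365445361200;
  0x2102436566352401; 0x2102456345361200; 0x2102463546350211;
  0x2102465345361200; 0x2102546345361200; 0x2102563466352401;
  0x2102564345361200; 0x2102645345361200; 0x2102654345361200;
  0x2103256456241300; 0x2103265456241300; 0x2103426566352401;
  0x2103456234251600; 0x2103462546350211; 0x2103465234251600;
  0x2103546234251600; 0x2103564234251600; 0x2103624566352401;
  0x2103645234251600; 0x2103654234251600; 0x1104326524563301;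
  0x2104365244352601; 0x1104562325663401; 0x2104563234251600;
  0x1104652325663401; 0x2104653234251600; 0x2105463234251600;
  0x2105643234251600; 0x2106345244352601; 0x2106453234251600;
  0x2106543234251600; 0x2120356445361200; 0x2120364545361200;
  0x2120365445361200; 0x2120456345361200; 0x2120463546351200;
  0x2120465345361200; 0x2120536456341200; 0x2120546345361200;
  0x2120563446351200; 0x2120564345361200; 0x2120634566352401;
  0x2120635456341200; 0x2120643546351200; 0x2120645345361200;
  0x2120653446351200; 0x2120654345361200; 0x2123065456241300;
  0x2123460546350211; 0x2123604566352401; 0x2125036456241300;
  0x2126035456241300; 0x2130265455461302; 0x2132065455461302;
  0x2134560233241506; 0x2134650233241506; 0x2135640233241506;
  0x2136540233241506; 0x2145603266051423; 0x2145630256041322;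
  0x2146503266051423; 0x2146530256041322; 0x2156042356041322;
  0x2156043256041322; 0x2156430256041322; 0x2210365455461302;
  0x2210465344352601; 0x2210563446350211; 0x2210564334251600;
  0x2210645345360211; 0x2210654334251600; 0x2215604333241506;
  0x2216054366051423; 0x2240651333241506; 0x2013526436251400;
  0x2013542666342501; 0x2013562436241500; 0x2013625436251400;
  0x2013642566342501; 0x2013652436241500; 0x1014352614562300;
  0x1014356214562300; 0x2014362544362501; 0x2014526335241600;
  0x2014536245361200; 0x2014625355362401; 0x2014635235261400;
  0x2015436235241600; 0x1015462325443601; 0x2015634233241506;
  0x1016354215362400; 0x2023451666342501; 0x2023461566342501;
  0x2023516436251400; 0x2023541666342501; 0x2023561436241500;
  0x2023615436251400; 0x2023641566342501; 0x2023651436241500;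
  0x1024153614562203; 0x1024156314562203; 0x1024356114562300;
  0x1024561325663401; 0x1024651325663401; 0x2025143666251403;
  0x2025163466251403; 0x1025314615332604; 0x1025364115332406;
  0x2025431636241500; 0x2025631436241500; 0x1025641314662305;
  0x1026153414562203; 0x1026154314562203; 0x1026314515332604;
  0x1026345115342206; 0x1026541314662305; 0x2032416556341200;
  0x2032456145361200; 0x2032614536251400; 0x2043256155461302;
  0x2045362134251600; 0x2045621333241506; 0x1045623114562300;
  0x1046352115332406; 0x1046523114562300; 0x1053426114562300;
  0x1054326114552306; 0x1054362115442306; 0x2103526436251400;
  0x2103562436241500; 0x2103625436251400; 0x2103642566342501;
  0x2103652436241500; 0x2104362544362501; 0x1104526324663501;
  0x2104536245360211; 0x1104635226443501; 0x2105436235241600;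
  0x2123506436251400; 0x2123560436241500; 0x2123605436251400;
  0x2123640566342501; 0x2123650436241500; 0x1124056314562203;
  0x2124065333041526; 0x1124560325663401; 0x1124650325663401;
  0x2125063466251403; 0x2125630436241500; 0x1125640314662305;
  0x2126045333041526; 0x1126053414562203; 0x1126054314562203;
  0x1126304515332604; 0x1126540314662305; 0x1130564225663401;
  0x1130654225663401; 0x2145602333241506; 0x1145620314662305;
  0x1146520314662305; 0x2150236455461302; 0x2150623456140322;
  0x2150624356140322; 0x1150643204562213; 0x1156023414562300;
  0x1156024314562300; 0x1156403203564412; 0x1215064315332406;
  0x1216504315442306; 0x1014532625443601; 0x1014632525443601;
  0x2015346244352601; 0x1015362425663401; 0x2015364244352601;
  0x2016435245361200; 0x2024163566451302; 0x2024165344352601;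
  0x1024316524561300; 0x1024351614662305; 0x2024513636251400;
  0x2024516335261400; 0x1025146314662503; 0x2025413636251400;
  0x2025613436251400; 0x1026143514562203; 0x2026145333241506;
  0x1026315415362204; 0x2026341546231500; 0x2026354156341200;
  0x1026451314362205; 0x2026513436251400; 0x1026514313562204;
  0x2034156255462301; 0x2034216556241300; 0x1035621425663401;
  0x2036214566251403; 0x1043562115342206; 0x1046521314662305;
  0x1053421614662305; 0x2056342134251600; 0x2056423134251600;
  0x2063542124351600; 0x2064325135241600; 0x2064352134251600;
  0x1104356226453301; 0x1104625324663501; 0x1104632525443601;
  0x2105634245360211; 0x2105642346350211; 0x2106354234251600;
  0x2106435235241600; 0x2124063566451302; 0x2124506335261400;
  0x2124605335261400; 0x2125046355461302; 0x2125064355461302;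
  0x2125603436251400; 0x1126043514552603; 0x1126305415362204;
  0x2126340546231500; 0x1126350414362205; 0x1126450314362205;
  0x2126503436251400; 0x1126504313562204; 0x2130465245361200;
  0x2130652466143502; 0x2134065246350211; 0x2140653214352600;
  0x2150263466153402; 0x1162340524331605; 0x2214065325460311;
  0x2251064314352600; 0x2024365146351200; 0x2024536156341200;
  0x2024613536251400; 0x2024615335261400; 0x2025164334251600;
  0x2025316455460312; 0x2025341666450312; 0x2025346166452301;
  0x2026351446231500; 0x2026413536251400; 0x2026415335261400;
  0x2026534156341200; 0x2032465145361200; 0x2034162545360211;
  0x2034165244352601; 0x2034256155462301; 0x2034512666352401;
  0x2034516235261400; 0x1035612424563301; 0x2035624166041325;
  0x2036512466352401; 0x2036514266450312; 0x2042356111342506;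
  0x2042653133241506; 0x1052346124563301; 0x2053462133241506;
  0x2053642133241506; 0x2056243156041322; 0x2062543125460311;
  0x2105346244352601; 0x2105364244352601; 0x1105462325443601;
  0x2124360546231500; 0x2124603536251400; 0x2125306455460312;
  0x2125360466231405; 0x2125406333261504; 0x2125604335261400;
  0x2126403536251400; 0x2126405335261400; 0x2126530436241500;
  0x2130462546351200; 0x2130625466153402; 0x1130645205662314;
  0x1132460503554612; 0x2134062566241305; 0x2134506233251604;
  0x2134605233251604; 0x1135602424563301; 0x1135620424563301;
  0x1136504203564412; 0x2140563255460312; 0x2140652366150423;
  0x2146053236051422; 0x1150642304562213; 0x1213605424563301;
  0x2214605333251604; 0x2024361545361200; 0x2024531636241500;
  0x2024635133241506; 0x2025361446231500; 0x2025416344352601;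
  0x2025614333241506; 0x2026435133241506; 0x2026531436241500;
  0x2032461546351200; 0x1032651414662305; 0x2034265144352601;
  0x2034526156341200; 0x2034612536251400; 0x2034615235261400;
  0x2035162446251300; 0x2035164255462301; 0x2035264144251603;
  0x2036154244251603; 0x2036451266051423; 0x2036524134251600;
  0x2042365134251600; 0x2042563166051423; 0x2046253136051422;
  0x2052643134251600; 0x1105362425663401; 0x2124630536241500;
  0x2125460334261500; 0x2126430536241500; 0x2130526456140322;
  0x1130546204562311; 0x2130642536241500; 0x2134260566241305;
  0x2134602566231405; 0x2135064266251403; 0x1135604224563301;
  0x2136025466152403; 0x2136054244251603; 0x2136450266051423;
  0x1140265313664502; 0x2140625322034516; 0x2145063244251603;
  0x2146052312463500; 0x2154603266452301; 0x2156402355460312;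
  0x2215063466051423; 0x2216045344352601; 0x2216503446350211;
  0x1230651424563301; 0x2250641356241300; 0x2024631536241500;
  0x2025461334261500; 0x2026431536241500; 0x2032516445361200;
  0x2032615435261400; 0x1032645115442306; 0x2034261545361200;
  0x2034521666352401; 0x2034625134251600; 0x1035614224563301;
  0x2036254134251600; 0x2036521455041326; 0x2042361544361205;
  0x2042651336241500; 0x2045263134251600; 0x2052641336241500;
  0x1054623115342206; 0x2056324166451302; 0x1130562435441602;
  0x2132560444361205; 0x1132605425331604; 0x2132650445361200;
  0x2134620566231405; 0x2135026466152403; 0x2135460266051423;
  0x1136052404563312; 0x2136502455461302; 0x2136520455041326;
  0x2140365234251600; 0x2142065315462300; 0x1146025314662503;
  0x1146502315662304; 0x2150264355461302; 0x2152063466152403;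
  0x1152064325663401; 0x2154602345361200; 0x2156320455041326;
  0x1156420303554612; 0x2215603433241506; 0x2216053466450312;
  0x2240615355360214; 0x2032546133241506; 0x2032561444352601;
  0x2032641536241500; 0x2034621536241500; 0x1035461214562300;
  0x1036251414662305; 0x2042615336251400; 0x2042635134251600;
  0x2043651233241506; 0x1046251315362400; 0x2054361211243506;
  0x2054631256042311; 0x2064523134251600; 0x2132640536241500;
  0x2135062444261305; 0x1135260415662403; 0x2140362514362500;
  0x1140562335441602; 0x2140635234251600; 0x2142360545361200;
  0x1142650324563301; 0x1145026324563301; 0x1145360225443601;
  0x1150246313554602; 0x2150346214352600; 0x2150634234251600;
  0x1152604325663401; 0x1152640324563301; 0x1154620314332605;
  0x2216305455461302; 0x2230561444352601; 0x2236051444261305;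
  0x1241605325663401; 0x1246015324563301; 0x2032541666352401;
  0x2035261434251600; 0x2036215455261304; 0x2042631555041236;
  0x2043615256340211; 0x2045361255462301; 0x1046235116342500;
  0x1046351215362400; 0x2052634166051423; 0x1053624114562300;
  0x1053641225663401; 0x2054621345361200; 0x2135206455261304;
  0x1136250414662305; 0x2140632555041236; 0x2142605334251600;
  0x2143065234051622; 0x1143560215342600; 0x1143650224563301;
  0x1145062315662403; 0x1145260325663401; 0x2146035233041625;
  0x2146250333061524; 0x2150364244352601; 0x2152046315462300;
  0x2153604266051423; 0x1153620414662305; 0x1154026324661503;
  0x1154062325663401; 0x2154360211243506; 0x2154630256042311;
  0x1156032425341600; 0x2156204336051422; 0x1156240304553612;
  0x2216405344352601; 0x2235061434251600; 0x2245061355043612;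
  0x1035216414562300; 0x2036415211364502; 0x2042516336251400;
  0x2042536166051423; 0x2043265134251600; 0x2043561245361200;
  0x2043625166452301; 0x2045261333241506; 0x1046231515342600;
  0x2052364166051324; 0x2053264133260514; 0x1053621414662305;
  0x2056341266350412; 0x2062453135241600; 0x2063254133241506;
  0x2063524134251600; 0x2136042522164503; 0x2136205455261304;
  0x2142560334150622; 0x2142630555041236; 0x2143602511263504;
  0x2143605233251604; 0x2143620566231405; 0x2145036256241300;
  0x2146205344352601; 0x2146350256341200; 0x1150426314553602;
  0x1150462335661402; 0x2150463244352601; 0x2150632446350211;
  0x2152406345361200; 0x2153062446350211; 0x2153064244352601;
  0x2153640256241300; 0x2156034246351200; 0x2156302411263504;
  0x2156304266051423; 0x2156340256041322; 0x1254061325663401;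
  0x2035241656231400; 0x2035246166352401; 0x1035416214562300;
  0x2035426156241300; 0x2036145233061524; 0x2036412566231405;
  0x2042561345361200; 0x1043261513462205; 0x1043516214562300;
  0x2043526156341200; 0x2043612544352601; 0x2043621555461302;
  0x2045236166352401; 0x1046315216332504; 0x2046325146351200;
  0x2052361446350211; 0x2052436134251600; 0x1052461335442601;
  0x2052463134251600; 0x2053261422361504; 0x2053461222361504;
  0x2054263144352601; 0x2056234166451302; 0x2062354134251600;
  0x2063425166051423; 0x2135046255241306; 0x2136045255241306;
  0x2136240556041322; 0x2136402533162504; 0x2136405246351200;
  0x2143260533241506; 0x2146230555041326; 0x1146302515332604;
  0x2146305244031625; 0x2146320555041326; 0x2150326455460312;
  0x2150362411463502; 0x2152603466352401; 0x2153406244051623;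
  0x2153460255041623; 0x1153602415342600; 0x2154063233061524;
  0x2154260356241300; 0x2156203416253400; 0x1156230414662305;
  0x1250461335661402; 0x2035142656241300; 0x2035146255461302;
  0x1035412614562300; 0x2035421611342506; 0x2036241556341200;
  0x2036245144352601; 0x2036425156041322; 0x1045231625663401;
  0x1045316214562300; 0x2045326166452301; 0x1046321515342600;
  0x2052431644231506; 0x2053246122341605; 0x2054236155012634;
  0x2135406255231406; 0x2136420566231405; 0x2145306255460312;
  0x2150436255460312; 0x2152360455461302; 0x2152460345361200;
  0x2152630445361200; 0x2153260455041326; 0x2154036266340215;
  0x2162430555012634; 0x2250361455461302; 0x2036421566231405;
  0x2045312645361200; 0x1045321625663401; 0x2063245134251600;
  0x2154306246351200]%num.

Definition representatives k :=
  nth [::] [:: [::]; entries_S1; entries_S2; entries_S3; entries_S4; entries_S5;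
               entries_S6; entries_S7] k.

Lemma certificates_triangular :
  all (fun k => triangular k (PositiveMap.empty _) (certificate k (representatives k)))
    (iota 1 7).
Proof. by vm_compute. Qed.

Theorem theorem3p1 (k : nat) (hk : 1 <= k <= 7) :
  exists (p : program) (b : nat) (time space : nat -> nat),
    [/\ 0 < b,
        soft_O time (fun n => n ^ 2),
        soft_O space (fun n => n ^ 2)
      & forall (n : nat) (pi : 'S_n),
          computes (word_size b n) p (perm_vector pi) (profile k pi)
            (time n) (space n)].
Proof.
have /(allP certificates_triangular) : k \in iota 1 7 by rewrite mem_iota.
move: (certificate _ _) => es es_triangular; have /andP[k_gt0 _] := hk.
exists (profile_program k es), (word_factor k es).
exists (profile_time k es), (profile_space k es).
split=> [|||n pi].
- by rewrite /word_factor addnS.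
- exact: profile_time_softO.
- exact: profile_space_softO.
- exact: profile_program_spec.
Qed.
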